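(* Let $(G,\mu)$ be a pmp groupoid and let $H\subseteq G$ be a subgroupoid of finite index in $G$. If $H$ (with the measure $\mu$ on $H^{(0)}=G^{(0)}$) is sofic, then $G$ is sofic.
   Context: A groupoid is a small category with all arrows invertible, identified with its set of arrows $G$; $s(g)=g^{-1}g$, $r(g)=gg^{-1}$, the unit space is $G^{(0)}=s(G)=r(G)$, and $gh$ is defined iff $s(g)=r(h)$. A discrete measurable groupoid is a groupoid with a standard Borel structure for which product and inverse are Borel and $s^{-1}(x)$ is countable for all $x\in G^{(0)}$. Its Borel full semigroup $[[G]]_B$ is the set of Borel $\alpha\subseteq G$ such that $s|_\alpha$ and $r|_\alpha$ are injective; it is an inverse monoid with $\alpha\beta=\{ab:a\in\alpha,b\in\beta,s(a)=r(b)\}$, $\alpha^{-1}=\{a^{-1}:a\in\alpha\}$ and unit $G^{(0)}$. A pmp groupoid $(G,\mu)$ is a discrete measurable groupoid $G$ with a Borel probability measure $\mu$ on $G^{(0)}$ such that $\mu(s(\alpha))=\mu(r(\alpha))$ for all $\alpha\in[[G]]_B$. The full semigroup $[[G]]$ is the metric quotient of $[[G]]_B$ under the pseudometric $d_\mu(\alpha,\beta)=\mu(s(\alpha\triangle\beta))$; it inherits the inverse monoid structure. The full group $[G]$ consists of those $\alpha$ with $s(\alpha)=r(\alpha)=G^{(0)}$ (no distinction is made between Borel and measured versions, i.e. between sets and their classes modulo null sets). Fix a free ultrafilter $\mathcal U$ on $\mathbb N$. For metric spaces $(M_k,d_k)$ of diameter $\le 1$, $\prod_{\mathcal U}M_k$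 is the metric quotient of $\prod_kM_k$ under $d_{\mathcal U}((x_k),(y_k))=\lim_{k\to\mathcal U}d_k(x_k,y_k)$. Ultraproducts of full semigroups are inverse monoids with coordinatewise operations. A pmp groupoid $G$ is sofic if there are a sequence $(G_k)$ of finite pmp groupoids and an isometric embedding (isometric semigroup homomorphism) $[[G]]\to\prod_{\mathcal U}[[G_k]]$. A subgroupoid is a Borel subset closed under products and inverses. A subgroupoid $H\subseteq G$ has finite index in $G$ if there exist $\psi_1,\dots,\psi_n\in[G]$ such that $\{\psi_iH:i=1,\dots,n\}$ is a partition of $G$, where $\psi_iH=\{gh:g\in\psi_i,h\in H,s(g)=r(h)\}$. In this case $H^{(0)}=G^{(0)}$. *)

(* Defs.v *)
From HB Require Import structures.
From mathcomp Require Import all_boot all_order all_algebra.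
From mathcomp Require Import all_classical all_reals all_analysis.

Set Implicit Arguments.
Unset Strict Implicit.
Unset Printing Implicit Defensive.

Import Order.TTheory GRing.Theory Num.Theory.
Import numFieldNormedType.Exports.

Local Open Scope classical_set_scope.
Local Open Scope ring_scope.

(* A standard Borel space: measurably isomorphic to the Borel sets of a Polish
   space, i.e. of a separable space whose topology is given by a complete
   metric (a Hausdorff pseudometric is a metric). *)
Definition standard_borel (R : realType) (d : measure_display)
    (T : measurableType d) : Prop :=
  exists (P : completePseudoMetricType R) (f : T -> P),
    [/\ hausdorff_space P,
        exists2 D : set P, countable D & dense D,
        bijective f &
        forall A : set T, measurable A <-> <<s @open P >> (f @` A)].

(* A groupoid identified with its set of arrows [A], a subset of an ambient
   type [T].  The operations are total on [T], but only the inverses of arrows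
   and the products [m g h] with [s g = r h] are meaningful; no axiom concerns
   the other values.  Units and objects are identified, with s(g) = g^-1 g and
   r(g) = g g^-1, so that the unit at the source of g is [s g] itself. *)
Record groupoid_axioms (T : Type) (A : set T) (m : T -> T -> T) (i : T -> T)
    : Prop := GroupoidAxioms {
  _ : forall g, A g -> A (i g);
  _ : forall g, A g -> i (i g) = g;
  _ : forall g h, A g -> A h -> m (i g) g = m h (i h) -> A (m g h);
  _ : forall g h, A g -> A h -> m (i g) g = m h (i h) ->
        m (i (m g h)) (m g h) = m (i h) h;
  _ : forall g h, A g -> A h -> m (i g) g = m h (i h) ->
        m (m g h) (i (m g h)) = m g (i g);
  _ : forall g h k, A g -> A h -> A k ->
        m (i g) g = m h (i h) -> m (i h) h = m k (i k) ->
        m (m g h) k = m g (m h k);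
  _ : forall g, A g -> m g (m (i g) g) = g;
  _ : forall g, A g -> m (m g (i g)) g = g
}.

Record groupoid (T : Type) := Groupoid {
  arrows : set T;
  gmul : T -> T -> T;
  ginv : T -> T;
  groupoidP : groupoid_axioms arrows gmul ginv
}.

Section GroupoidTheory.
Context {T : Type}.
Implicit Types (G : groupoid T) (a b : set T).

Definition src G (g : T) : T := gmul G (ginv G g) g.
Definition rng G (g : T) : T := gmul G g (ginv G g).
Definition units G : set T := src G @` arrows G.

Definition composable G : set (T * T) :=
  [set p | [/\ arrows G p.1, arrows G p.2 & src G p.1 = rng G p.2]].

Definition set_gmul G a b : set T :=
  [set gmul G p.1 p.2 | p in (a `*` b) `&` composable G].

End GroupoidTheory.

(* A Borel subset of a standard Borel space is standard Borel, so the standard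
   Borel structure on the arrows is given by a Borel embedding in [T]; the case
   [arrows G = setT] is the literal one, and with this presentation a
   subgroupoid lives in the same ambient space. *)
Record discrete_measurable (R : realType) (d : measure_display)
    (T : measurableType d) (G : groupoid T) : Prop := DiscreteMeasurable {
  _ : standard_borel R T;
  _ : measurable (arrows G);
  _ : measurable_fun (arrows G) (ginv G);
  _ : measurable (composable G);
  _ : measurable_fun (composable G) (fun p => gmul G p.1 p.2);
  _ : forall x, units G x -> countable [set g | arrows G g /\ src G g = x]
}.

(* The Borel full semigroup [[G]]_B. *)
Definition full_semigroup_B (d : measure_display) (T : measurableType d)
    (G : groupoid T) : set (set T) :=
  [set a | [/\ measurable a, a `<=` arrows G,
               set_inj a (src G) & set_inj a (rng G)]].

(* A Borel probability measure on the unit space is a probability measure on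
   the ambient space giving full measure to the units. *)
Record pmp_groupoid (R : realType) (d : measure_display)
    (T : measurableType d) (G : groupoid T) (mu : probability T R) : Prop :=
  PmpGroupoid {
    _ : discrete_measurable R G;
    _ : mu (units G) = 1%E;
    _ : forall a, full_semigroup_B G a -> mu (src G @` a) = mu (rng G @` a)
  }.

(* A semigroup with a pseudometric, on the subset [pdom] of [pcar]; it stands
   for its metric quotient, in which x and y are equal iff [pdist x y = 0]. *)
Record pmetric_semigroup (R : realType) := PMetricSemigroup {
  pcar : Type;
  pdom : set pcar;
  pdist : pcar -> pcar -> R;
  pmul : pcar -> pcar -> pcar
}.

(* The full semigroup [[G]], with d_mu(a, b) = mu(s(a /_\ b)). *)
Definition full_semigroup (R : realType) (d : measure_display)
    (T : measurableType d) (G : groupoid T) (mu : probability T R) :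
    pmetric_semigroup R :=
  {| pcar := set T;
     pdom := full_semigroup_B G;
     pdist := fun a b => fine (mu (src G @` (a `+` b)));
     pmul := set_gmul G |}.

Definition free_ultrafilter (U : set_system nat) : Prop :=
  UltraFilter U /\ forall k, ~ U [set k].

Definition ultraproduct (R : realType) (U : set_system nat)
    (M : nat -> pmetric_semigroup R) : pmetric_semigroup R :=
  {| pcar := forall k, pcar (M k);
     pdom := [set x | forall k, pdom (x k)];
     pdist := fun x y => lim ((fun k => pdist (x k) (y k)) @ U);
     pmul := fun x y k => pmul (x k) (y k) |}.

(* An isometric semigroup homomorphism between the metric quotients of M and N,
   given by a map [f] choosing representatives.  The isometry condition makes
   the map induced by [f] well defined, and the last condition is
   multiplicativity in the quotient. *)
Definition isometric_embedding (R : realType) (M N : pmetric_semigroup R)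
    (f : pcar M -> pcar N) : Prop :=
  [/\ forall x, pdom x -> pdom (f x),
      forall x y, pdom x -> pdom y -> pdist (f x) (f y) = pdist x y &
      forall x y, pdom x -> pdom y ->
        pdist (f (pmul x y)) (pmul (f x) (f y)) = 0].

Definition sofic (R : realType) (U : set_system nat) (d : measure_display)
    (T : measurableType d) (G : groupoid T) (mu : probability T R) : Prop :=
  exists (d_ : nat -> measure_display) (T_ : forall k, measurableType (d_ k))
         (G_ : forall k, groupoid (T_ k)) (mu_ : forall k, probability (T_ k) R),
    (forall k, pmp_groupoid (G_ k) (mu_ k) /\ finite_set (arrows (G_ k))) /\
    exists f : pcar (full_semigroup G mu) ->
               pcar (ultraproduct U (fun k => full_semigroup (G_ k) (mu_ k))),
      isometric_embedding f.

(* The full group [G]: as sets are considered modulo null sets, the source and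
   the range are required to be conull. *)
Definition full_group (R : realType) (d : measure_display)
    (T : measurableType d) (G : groupoid T) (mu : probability T R) :
    set (set T) :=
  [set a | [/\ full_semigroup_B G a,
               mu.-negligible (units G `\` (src G @` a)) &
               mu.-negligible (units G `\` (rng G @` a))]].

Record is_subgroupoid (d : measure_display) (T : measurableType d)
    (G : groupoid T) (H : set T) : Prop := IsSubgroupoid {
  subgroupoid_measurable : measurable H;
  subgroupoid_sub : H `<=` arrows G;
  subgroupoid_mul : forall g h, H g -> H h -> src G g = rng G h ->
    H (gmul G g h);
  subgroupoid_inv : forall g, H g -> H (ginv G g)
}.

Lemma subgroupoid_axioms (d : measure_display) (T : measurableType d)
    (G : groupoid T) (H : set T) :
  is_subgroupoid G H -> groupoid_axioms H (gmul G) (ginv G).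
Proof.
case: G => A m i [a1 a2 a3 a4 a5 a6 a7 a8] [_ /= HA HM HI].
split=> //.
- by move=> g /HA; apply: a2.
- by move=> g h /HA Ag /HA Ah; apply: a4.
- by move=> g h /HA Ag /HA Ah; apply: a5.
- by move=> g h k /HA Ag /HA Ah /HA Ak; apply: a6.
- by move=> g /HA; apply: a7.
- by move=> g /HA; apply: a8.
Qed.

Definition subgroupoid (d : measure_display) (T : measurableType d)
    (G : groupoid T) (H : set T) (HG : is_subgroupoid G H) : groupoid T :=
  Groupoid (subgroupoid_axioms HG).

(* The sets psi_i H partition G; as psi_i is only defined modulo null sets,
   this is required modulo sets of arrows with null source. In particular every
   partition in the strict sense is allowed. *)
Definition finite_index (R : realType) (d : measure_display)
    (T : measurableType d) (G : groupoid T) (mu : probability T R)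
    (H : set T) : Prop :=
  exists (n : nat) (psi : 'I_n -> set T),
    [/\ forall i, full_group G mu (psi i),
        mu.-negligible
          (src G @` (arrows G `\` \bigcup_i set_gmul G (psi i) H)) &
        forall i j, i != j -> mu.-negligible
          (src G @` (set_gmul G (psi i) H `&` set_gmul G (psi j) H))].

(* Main.v *)
(* Let f be the embedding of [[H]] and write a_ij for the intersection of H with
   psi_i^-1 a psi_j.  As the cosets psi_i H partition G, a |-> (a_ij) behaves like
   the passage to block matrices: (ab)_il is the disjoint union over j of the
   a_ij b_jl, the a_ij with fixed j have disjoint sources, those with fixed i have
   disjoint ranges, and for each j the union over i of the s(a_ij /_\ b_ij) has the
   same measure as s(a /_\ b).  Hence a |-> U_ij f(a_ij) x {(i, j)} embeds [[G]]
   into the ultraproduct of the [[G_k x I_n^2]], up to deleting negligible overlaps.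

   That f respects disjointness, intersections, differences and unions modulo null
   sets follows from multiplicativity and isometry alone: d(f(0), f(1)) = 1 and
   f(0) <= f(1) force f(0) = 0, so that f preserves the measure of sources, and the
   measure of s(a n b) is a function of d(a, b) and the measures of s(a), s(b) and
   s(a) n s(b).  This is carried out in the disjoint union of the G_k, with the
   limit of the measures along the ultrafilter as a finitely additive measure.

   Sources and products of Borel bisections are Borel by the Lusin-Souslin theorem:
   a Borel set of a Polish space is a continuous injective image of a closed
   subset of the Baire space, and disjoint analytic sets are Borel separated. *)

From HB Require Import structures.
Require Import Defs.
From mathcomp Require Import all_boot all_order all_algebra.
From mathcomp Require Import all_classical all_reals all_analysis.
From mathcomp Require Import lra measurable_realfun.

Set Implicit Arguments.
Unset Strict Implicit.
Unset Printing Implicit Defensive.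

Import Order.TTheory GRing.Theory Num.Theory.
Import numFieldNormedType.Exports.

Local Open Scope classical_set_scope.
Local Open Scope ring_scope.

(** * The Lusin-Souslin theorem *)

(** The cosets cover and are disjoint only up to null sets, and each psi_i has only conull source
    and range, so the block identities hold modulo null sets and have to be carried through an
    embedding that sees nothing but distances and products. Finite index enters twice: the unions
    over coset indices are finite, so that a finitely additive limit measure can handle them, and
    the amplification of a finite groupoid stays finite. The weight 1/n on the n diagonal blocks
    restores total mass 1; averaging loses nothing because every column of the block matrix has the
    same measure.

    Measurability is a genuine obstacle: the given embedding controls Borel bisections only, so
    blocks, their sources and their products must be Borel before it can be applied to them.
    Soficity moreover asks for approximating groupoids on standard Borel spaces with a probability
    measure; as they are finite, the amplified ones are simply coded by real numbers. *)

Lemma countableU (X : Type) (A B : set X) :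
  countable A -> countable B -> countable (A `|` B).
Proof.
move=> cA cB; have -> : A `|` B = \bigcup_(b in [set: bool]) (if b then A else B).
  apply/seteqP; split=> x /=; first by move=> []; [exists true|exists false].
  by move=> [[] _]; [left|right].
by apply: bigcup_countable => [|[]]; first exact: countableP.
Qed.

Lemma first_hit (X : Type) (D : nat -> set X) : (forall x, exists i, D i x) ->
  exists l : X -> nat,
    forall x, D (l x) x /\ forall i, (i < l x)%N -> ~ D i x.
Proof.
move=> Dcover; suff : forall x, exists n,
    D n x /\ forall i, (i < n)%N -> ~ D i x by move=> /choice[l lP]; exists l.
move=> x; have [i Di] := Dcover x.
have ex : exists n, `[< D n x >] by exists i; apply/asboolP.
case: (ex_minnP ex) => m /asboolP Dm mmin; exists m; split=> // j jm Dj.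
by have /mmin := asboolT Dj; rewrite leqNgt jm.
Qed.

(** * Codings by closed subsets of the Baire space *)

Section Labels.
Context {X : Type}.
Implicit Types (L S : set (X -> nat)) (l : X -> nat) (A : set X).

(* [L] embeds X in nat^L; completeness says that the image is closed. *)
Definition complete_labels L := forall b : (X -> nat) -> nat,
  (forall S, finite_set S -> S `<=` L -> exists x, forall l, S l -> l x = b l) ->
  exists x, forall l, L l -> l x = b l.

Definition separating_labels L :=
  forall x y, (forall l, L l -> l x = l y) -> x = y.

Definition decides l A := forall x y, l x = l y -> A x -> A y.

(** A refinement of topology: when [L0] separates points, enlarging it to [L] still presents the
    space as a closed subset of the Baire space, while [A] becomes clopen because a single
    coordinate decides it. *)
Definition coded L0 A := exists L l,
  [/\ countable L, complete_labels L, L0 `<=` L, L l & decides l A].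

(** Each [L k] produces its own limit point. These points coincide, since all of them realise [b] on
    the common separating family [L0]. *)
Lemma complete_bigcup L0 (L : nat -> set (X -> nat)) : separating_labels L0 ->
  (forall k, L0 `<=` L k) -> (forall k, complete_labels (L k)) ->
  complete_labels (\bigcup_k L k).
Proof.
move=> sep L0L Lc b bfin.
have /choice[x xP] : forall k, exists x, forall l, L k l -> l x = b l.
  by move=> k; apply: Lc => S fS SL; apply: bfin => // l Sl; exists k => //; apply: SL.
exists (x 0%N) => l [k _ Lkl]; suff -> : x 0%N = x k by exact: xP.
by apply: sep => l0 Ll0; rewrite (xP 0%N) ?(xP k)//; apply: L0L.
Qed.

Lemma coded_setC L0 A : coded L0 A -> coded L0 (~` A).
Proof.
move=> [L [l [cL coL sub Ll dec]]]; exists L, l; split=> // x y lxy nAx Ay.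
by apply: nAx; apply: (dec y).
Qed.

Lemma coded_family L0 (A : nat -> set X) : separating_labels L0 ->
  (forall k, coded L0 (A k)) ->
  exists L, [/\ countable L, complete_labels L, L0 `<=` L &
    forall k, exists2 l, L l & decides l (A k)].
Proof.
move=> sep /choice[L /choice[l Ll]]; exists (\bigcup_k L k); split.
- by apply: bigcup_countable => // k _; case: (Ll k).
- by apply: (complete_bigcup sep) => k; case: (Ll k).
- by move=> l0 L0l0; exists 0%N => //; case: (Ll 0%N) => _ _ + _ _; apply.
- by move=> k; case: (Ll k) => _ _ _ Lk dk; exists (l k) => //; exists k.
Qed.

(* The added label is the first index of a set containing the point; its
   constancy along an approximating sequence passes to the limit because the
   sets [A k] are decided. *)
Lemma coded_bigcup L0 (A : nat -> set X) : separating_labels L0 ->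
  (forall k, coded L0 (A k)) -> coded L0 (\bigcup_k A k).
Proof.
move=> sep /(coded_family sep)[L [cL coL sub decL]].
(* Index 0 is reserved for the complement of the union, so that every point is hit; [A k] has index
   [k.+1]. *)
have [|f fP] := @first_hit X (fun i => if i is k.+1 then A k else
     ~` \bigcup_k A k).
  move=> x; have [[k _ Akx]|nA] := pselect ((\bigcup_k A k) x); first by exists k.+1.
  by exists 0%N.
have f0 x : f x = 0%N <-> ~ (\bigcup_k A k) x.
  split=> [fx|nA]; first by have [] := fP x; rewrite fx.
  by apply/eqP; apply: contraPT (nA) => fx0; have [_ /(_ 0%N)] := fP x;
    rewrite lt0n fx0 => /(_ isT) nn _; apply: nn.
exists (L `|` [set f]), f; split.
- exact: countableU.
- move=> b bfin.
  have [x xP] : exists x, forall l, L l -> l x = b l.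
    apply: coL => S fS SL; apply: bfin => // l Sl; left; exact: SL.
  exists x => l [|->]; first exact: xP.
  have /choice[d dP] : forall k, exists l, L l /\ decides l (A k).
    by move=> k; have [l0 ? ?] := decL k; exists l0.
  case bf : (b f) => [|k].
    apply/f0 => -[k _ Akx].
    have [||x' x'P] := bfin [set d k; f]; first by [].
      by move=> _ [->|->]; [left; case: (dP k)|right].
    have /f0 : f x' = 0%N by rewrite -bf; apply: x'P; right.
    apply; exists k => //; have [Ldk dec] := dP k; apply: (dec x) => //.
    by rewrite xP// x'P//; left.
  (* Whether the first hit is at [k.+1] depends only on the labels that decide [A 0] to [A k].
     Agreement with [x'] on these finitely many labels forces the same first hit on the limit point
     [x]. *)
  have [||x' x'P] := bfin ((d @` `I_k.+1) `|` [set f]).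
  + by rewrite finite_setU; split=> //; apply: finite_image.
  + by move=> _ [[j _ <-]|->]; [left; case: (dP j)|right].
  have fx' : f x' = k.+1 by rewrite -bf; apply: x'P; right.
  have dd j : (j <= k)%N -> A j x <-> A j x'.
    move=> jk; have [Ld dec] := dP j.
    have e : d j x = d j x' by rewrite xP// x'P//; left; exists j.
    by split; apply: dec.
  have [] := fP x'; rewrite fx' => Akx' nAx'.
  have Akx : A k x by apply/dd.
  case fx : (f x) => [|j].
    by move/f0: fx; case; exists k.
  have [] := fP x; rewrite fx => Ajx nAx.
  congr S; apply/eqP; rewrite eqn_leq; apply/andP; split; rewrite leqNgt.
    by apply/negP => kj; apply: (nAx k.+1) => //.
  apply/negP => jk; apply: (nAx' j.+1) => //; apply/dd => //; exact: ltnW.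
- by move=> l0 L0l0; left; apply: sub.
- by right.
- by move=> x y fxy; apply: contraPP => /f0; rewrite -fxy => /f0.
Qed.

Lemma coded_sigma_algebra L0 : separating_labels L0 -> countable L0 ->
  complete_labels L0 -> L0 !=set0 -> sigma_algebra setT (coded L0).
Proof.
move=> sep cL coL [l Ll]; split.
- by exists L0, l; split.
- by move=> A; rewrite setTD; apply: coded_setC.
- by move=> A Ac; apply: coded_bigcup.
Qed.

End Labels.

(* A set with its Borel structure replaced by the labels that witness that it
   is a continuous injective image of a closed subset of the Baire space. *)
Definition lusin_space (d : measure_display) (T : measurableType d) :=
  exists L0 : set (T -> nat), [/\ separating_labels L0, countable L0,
    complete_labels L0, L0 !=set0 & forall A, measurable A -> coded L0 A].

(** * Labels with F-sigma fibres *)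

Section FSigma.
Context {P : topologicalType}.
Implicit Types A B : set P.

Definition fsigma A := exists C : nat -> set P,
  (forall i, closed (C i)) /\ A = \bigcup_i C i.

Lemma fsigma_closed A : closed A -> fsigma A.
Proof. by move=> cA; exists (fun=> A); split=> //; rewrite bigcup_const. Qed.

Lemma fsigma_bigcup (A : nat -> set P) :
  (forall i, fsigma (A i)) -> fsigma (\bigcup_i A i).
Proof.
move=> /choice[C CP].
exists (fun n => let p := odflt (0%N, 0%N) (unpickle n) in C p.1 p.2); split.
  by move=> i; case: (CP (odflt (0%N, 0%N) (unpickle i)).1).
apply/seteqP; split=> [x [i _]|x [n _ Cx]].
  by case: (CP i) => _ -> [j _ Cx]; exists (pickle (i, j)) => //=; rewrite pickleK.
by exists (odflt (0%N, 0%N) (unpickle n)).1 => //;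
   case: (CP (odflt (0%N, 0%N) (unpickle n)).1) => _ ->;
   exists (odflt (0%N, 0%N) (unpickle n)).2.
Qed.

Lemma fsigmaI A B : fsigma A -> fsigma B -> fsigma (A `&` B).
Proof.
move=> [C [cC ->]] [D [cD ->]]; rewrite setI_bigcupl.
apply: fsigma_bigcup => i; rewrite setI_bigcupr; exists (fun j => C i `&` D j).
by split=> // j; apply: closedI.
Qed.

Definition fsigma_label (l : P -> nat) := forall c, fsigma (l @^-1` [set c]).

(** The fibres of [l] need not be closed, so a limit of points with the same label may lose it. The
    new label names the first closed piece of the fibre that contains the point; a limit along
    constant values of both labels stays in that piece, hence in the fibre. *)
Lemma fsigma_label_next (openF : forall A, open A -> fsigma A) l :
  fsigma_label l -> exists2 l', fsigma_label l' &
    forall c c', closure (l @^-1` [set c] `&` l' @^-1` [set c']) `<=`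
                 l @^-1` [set c].
Proof.
move=> /choice[C CP].
have CE c x : l x = c <-> exists i, C c i x.
  have [_ E] := CP c; split=> [lx|[i Cx]].
    by have : (l @^-1` [set c]) x by []; rewrite E => -[i _ ?]; exists i.
  by have : (l @^-1` [set c]) x by rewrite E; exists i.
have [|l' l'P] := @first_hit P (fun i x => C (l x) i x).
  by move=> x; apply/CE.
exists l' => [i|c i].
  have -> : l' @^-1` [set i] =
      \bigcup_c (C c i `&` ~` \bigcup_(j < i) C c j).
    apply/seteqP; split=> [x <-|x [c _ [Cx nC]]].
      by exists (l x) => //; have [? nC] := l'P x; split=> // -[j /nC].
    have lx : l x = c by apply/CE; exists i.
    have [] := l'P x; rewrite lx => C1 C2.
    suff : l' x = i by [].
    apply/eqP; rewrite eqn_leq; apply/andP; split; rewrite leqNgt;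
      apply/negP => h; first exact: (C2 _ h).
    by apply: nC; exists (l' x).
  apply: fsigma_bigcup => c; apply: fsigmaI.
    by apply: fsigma_closed; case: (CP c).
  apply: openF; apply: closed_openC; rewrite bigcup_mkord.
  by apply: closed_bigsetU => j _; case: (CP c).
apply: (@subset_trans _ (C c i)); last by move=> x Cx; apply/CE; exists i.
have [cC _] := CP c; have := cC i => /closure_id ->.
by apply: closureS => x /= [<- <-]; have [] := l'P x.
Qed.

End FSigma.

(** The closures do not leave [A]: a limit point lies in the ball of fixed radius around a nearby
    point of the set, and that ball is contained in [A]. *)
Lemma fsigma_open (R : realType) (P : pseudoMetricType R) (A : set P) :
  open A -> fsigma A.
Proof.
move=> oA; exists (fun i => closure [set x | ball x (i.+1%:R^-1 : R) `<=` A]).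
split=> [i|]; first exact: closed_closure.
apply/seteqP; split=> [x Ax|x [i _ clx]].
  have /nbhs_ballP[e e0 eA] : nbhs x A by apply: open_nbhs_nbhs.
  have [i ie] : exists i, (i.+1%:R^-1 : R) < e.
    exists (Num.truncn e^-1); rewrite invf_plt ?posrE ?ltr0n//.
    exact: truncnS_gt.
  by exists i => //; apply: subset_closure => y xy; apply: eA;
    apply: (le_ball (ltW ie)).
have i0 : 0 < i.+1%:R^-1 :> R by rewrite invr_gt0 ltr0n.
have [y [bA xy]] := clx _ (nbhsx_ballx x (i.+1%:R^-1 : R) i0).
by apply: bA; apply: ball_sym.
Qed.

(** * Polish spaces as coded spaces *)

Section Polish.
Context {R : realType} (P : completePseudoMetricType R).
Variable D : set P.
Hypotheses (hausP : hausdorff_space P) (cD : countable D) (dD : dense D).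

Let rad (n : nat) : R := n.+1%:R^-1.
Let rad_gt0 n : 0 < rad n. Proof. by rewrite invr_gt0 ltr0n. Qed.

Let rad_lt e : 0 < e -> exists n, rad n < e.
Proof.
move=> e0; exists (Num.truncn e^-1); rewrite /rad invf_plt ?posrE ?ltr0n//.
exact: truncnS_gt.
Qed.

Lemma polish_base : exists B : nat -> nat -> set P,
  [/\ forall n j, open (B n j), forall n x, exists j, B n j x &
      forall n j x y, B n j x -> B n j y -> ball x (rad n) y].
Proof.
have /countable_injP[g gi] := cD.
exists (fun n j => \bigcup_(p in D `&` (fun p => g p = j)) (ball p (rad n / 2))^°).
split.
- by move=> n j; apply: bigcup_open => p _; apply: open_interior.
- move=> n x; have r4 : 0 < rad n / 2 / 2 by rewrite !divr_gt0.
  have [||p [xp Dp]] := dD (O := (ball x (rad n / 2 / 2))^°).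
  + by exists x; apply: nbhsx_ballx.
  + exact: open_interior.
  exists (g p), p => //; apply: (@filterS _ _ _ (ball x (rad n / 2 / 2))).
    move=> y xy; rewrite (splitr (rad n / 2)); apply: (ball_triangle _ xy).
    by apply: ball_sym; apply: interior_subset xp.
  exact: nbhsx_ballx.
- move=> n j x y [p [Dp gp] px] [q [Dq gq] qy].
  have pq : p = q by apply: gi; rewrite ?inE// gp gq.
  rewrite (splitr (rad n)); apply: (@ball_triangle _ _ p).
    by apply: ball_sym; apply: interior_subset px.
  by rewrite pq; apply: interior_subset qy.
Qed.

(** The label [h n 0] names a small open set around the point, and [h n k.+1] names a closed piece
    of the fibre of [h n k]. Consistent values make the approximating points Cauchy by the labels
    [h n 0], and the limit keeps the value of [h n k] thanks to [h n k.+1]. *)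
Lemma polish_coding : exists L0 : set (P -> nat),
  [/\ separating_labels L0, countable L0, complete_labels L0, L0 !=set0 &
    forall A, open A -> coded L0 A].
Proof.
have [B [Bo Bcover Bball]] := polish_base.
have /choice[f fP] : forall n, exists l : P -> nat,
    forall x, B n (l x) x /\ forall i, (i < l x)%N -> ~ B n i x.
  by move=> n; apply: first_hit.
have fF n : fsigma_label (f n).
  move=> c; have -> : f n @^-1` [set c] = B n c `&` ~` \bigcup_(i < c) B n i.
    apply/seteqP; split=> [x <-|x [Bx nB]].
      by have [? nB] := fP n x; split=> // -[j /nB].
    suff : f n x = c by [].
    have [B1 B2] := fP n x.
    apply/eqP; rewrite eqn_leq; apply/andP; split; rewrite leqNgt;
      apply/negP => h; first exact: (B2 _ h).
    by apply: nB; exists (f n x).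
  apply: fsigmaI; first exact: (@fsigma_open R).
  by apply: fsigma_closed; apply: open_closedC; apply: bigcup_open.
have /choice[nx nxP] : forall l : P -> nat, exists l' : P -> nat,
    fsigma_label l -> fsigma_label l' /\
    forall c c', closure (l @^-1` [set c] `&` l' @^-1` [set c']) `<=`
                 l @^-1` [set c].
  move=> l; have [Fl|] := pselect (fsigma_label l); last by exists l.
  by have [l' ? ?] := fsigma_label_next (@fsigma_open R P) Fl; exists l'.
pose h n k := iter k nx (f n).
have hF n k : fsigma_label (h n k).
  by elim: k => [|k ih]; [exact: fF|case: (nxP _ ih)].
have hcl n k c c' : closure (h n k @^-1` [set c] `&` h n k.+1 @^-1` [set c'])
    `<=` h n k @^-1` [set c] by case: (nxP _ (hF n k)).
have hball n x y : h n 0%N x = h n 0%N y -> ball x (rad n) y.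
  move=> e; apply: (Bball n (f n x)); first by case: (fP n x).
  by have -> : f n x = f n y by []; case: (fP n y).
pose L0 : set (P -> nat) := range (fun p : nat * nat => h p.1 p.2).
have L0h n k : L0 (h n k) by exists (n, k).
have sepL0 : separating_labels L0.
  move=> x y exy; apply: hausP => V W; rewrite -!nbhs_ballE.
  move=> [/= e e0 xV] [/= e' e'0 yW].
  have [n ne] := rad_lt e0; exists y; split.
    by apply: xV; apply: (le_ball (ltW ne)); apply: hball; apply: exy.
  by apply: yW; apply: ballxx.
have cL0 : countable L0 by apply: card_le_trans (card_image_le _ _) _; apply: countableP.
have coL0 : complete_labels L0.
  move=> b bfin.
  have /choice[x xP] : forall N, exists x, forall n k, (n < N)%N -> (k < N)%N ->
      h n k x = b (h n k).
    move=> N; have [||x xP] := bfin ((fun p : nat * nat => h p.1 p.2) @` (`I_N `*` `I_N)).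
    - by apply: finite_image; apply: finite_setX.
    - by move=> _ [p _ <-].
    by exists x => n k nN kN; apply: xP; exists (n, k).
  have xcauchy : cauchy (x @ \oo).
    apply/cauchy_exP => e e0; have [n ne] := rad_lt e0; exists (x n.+1).
    exists n.+1 => // m /= nm; apply: (le_ball (ltW ne)); apply: hball.
    by rewrite !xP//; apply: leq_trans nm.
  have xy : cvg (x @ \oo) by apply/cauchy_cvgP.
  move: xy; set y := lim (x @ \oo) => xy.
  exists y => _ [[n k] _ <-] /=.
  suff : (h n k @^-1` [set b (h n k)]) y by [].
  apply: (hcl n k _ (b (h n k.+1))) => V /xy [N _ NV].
  (* The point [x m] carries the prescribed labels for indices below [m] only; here [n], [k] and
     [k.+1] must all be covered. *)
  exists (x (maxn N (maxn n.+1 k.+2))); split; last by apply: NV => /=; apply: leq_maxl.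
  by split; apply: xP; rewrite !leq_max ?leqnn ?leqnSn ?orbT.
have L00 : L0 !=set0 by exists (h 0%N 0%N).
exists L0; split=> // A oA.
have [c0 cC cU] := coded_sigma_algebra sepL0 cL0 coL0 L00.
have -> : A = \bigcup_n \bigcup_j
    (if pselect (h n 0%N @^-1` [set j] `<=` A) then h n 0%N @^-1` [set j] else set0).
  apply/seteqP; split=> [x Ax|x [n _ [j _]]]; last by case: pselect => [jA /jA|].
  have /nbhs_ballP[e e0 eA] : nbhs x A by apply: open_nbhs_nbhs.
  have [n ne] := rad_lt e0; exists n => //; exists (h n 0%N x) => //.
  case: pselect => //; case=> y /= yx; apply: eA; apply: (le_ball (ltW ne)).
  by apply: hball.
apply: (cU) => n; apply: (cU) => j; case: pselect => [jA|_] //.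
by exists L0, (h n 0%N); split=> // x y e /= <-.
Qed.

Lemma polish_separating : exists V : nat -> set P, (forall k, open (V k)) /\
  forall x y, (forall k, V k x <-> V k y) -> x = y.
Proof.
have [B [Bo Bcover Bball]] := polish_base.
pose p k := odflt (0%N, 0%N) (unpickle k : option (nat * nat)).
exists (fun k => B (p k).1 (p k).2); split=> // x y exy.
apply: hausP => V W; rewrite -!nbhs_ballE => -[/= e e0 xV] [/= e' e'0 yW].
have [n ne] := rad_lt e0; exists y; split; last by apply: yW; apply: ballxx.
apply: xV; apply: (le_ball (ltW ne)); have [j Bx] := Bcover n x.
apply: (Bball n j) => //; have := exy (pickle (n, j)).
by rewrite /p pickleK /= => -[+ _]; apply.
Qed.

End Polish.

Section StandardBorel.
Context {R : realType} {d : measure_display} {T : measurableType d}.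

Lemma standard_borel_lusin : standard_borel R T -> lusin_space T.
Proof.
move=> [P [f [haus [D cD dD] [g fg gf] mE]]].
have [L0 [sep cL coL [l0 Ll0] openL]] := polish_coding haus cD dD.
pose pull (L : set (P -> nat)) : set (T -> nat) := (fun l => l \o f) @` L.
have pull_co L : complete_labels L -> complete_labels (pull L).
  move=> co b bfin; have [|x xP] := co (fun l => b (l \o f)).
    move=> S fS SL; have [||x xP] := bfin (pull S).
    - exact: finite_image.
    - exact: image_subset.
    by exists (f x) => l Sl; have := xP (l \o f); apply; exists l.
  by exists (g x) => _ [l Ll <-] /=; rewrite gf xP.
have cpull L : countable L -> countable (pull L).
  by apply: card_le_trans; apply: card_image_le.
exists (pull L0); split=> //.
- move=> x y e; rewrite -(fg x) -(fg y); congr g; apply: sep => l Ll.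
  by apply: (e (l \o f)); exists l.
- exact: cpull.
- exact: pull_co.
- by exists (l0 \o f), l0.
- move=> A /mE.
  have : <<s @open P >> `<=` coded L0.
    apply: smallest_sub => //; apply: coded_sigma_algebra => //; by exists l0.
  move=> /[apply] -[L [l [cL' coL' sub Ll dec]]].
  exists (pull L), (l \o f); split.
  + exact: cpull.
  + exact: pull_co.
  + exact: image_subset.
  + by exists l.
  + move=> x y e Ax; have [] := dec _ _ e; first by exists x.
    by move=> z Az fzy; rewrite -(fg y) -fzy fg.
Qed.

Lemma standard_borel_separating : standard_borel R T ->
  exists V : nat -> set T, (forall k, measurable (V k)) /\
    forall x y, (forall k, V k x <-> V k y) -> x = y.
Proof.
move=> [P [f [haus [D cD dD] [g fg gf] mE]]].
have [V [oV sepV]] := polish_separating haus cD dD.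
exists (fun k => f @^-1` (V k)); split.
  move=> k; apply/mE; rewrite image_preimage; first by apply: sub_sigma_algebra.
  by apply/seteqP; split=> // y _; exists (g y).
by move=> x y e; rewrite -(fg x) -(fg y); congr g; apply: sepV.
Qed.

End StandardBorel.

(** * Products of coded spaces *)

Section Product.
Context {X Y : Type}.

Definition join_labels (L : set (X -> nat)) (M : set (Y -> nat)) : set (X * Y -> nat) :=
  ((fun l p => l p.1) @` L) `|` ((fun l p => l p.2) @` M).

Lemma complete_join L M : complete_labels L -> complete_labels M ->
  complete_labels (join_labels L M).
Proof.
move=> cL cM b bfin.
have [|x xP] := cL (fun l => b (fun p => l p.1)).
  move=> S fS SL; have [||[x y] xP] := bfin ((fun l p => l p.1) @` S).
  - exact: finite_image.
  - by apply: subset_trans (image_subset _ SL) _; apply: subsetUl.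
  by exists x => l Sl; apply: (xP (fun p => l p.1)); exists l.
have [|y yP] := cM (fun l => b (fun p => l p.2)).
  move=> S fS SL; have [||[x' y] yP] := bfin ((fun l p => l p.2) @` S).
  - exact: finite_image.
  - by apply: subset_trans (image_subset _ SL) _; apply: subsetUr.
  by exists y => l Sl; apply: (yP (fun p => l p.2)); exists l.
by exists (x, y) => _ [[l Ll <-]|[l Ml <-]] /=; [apply: xP|apply: yP].
Qed.

Lemma countable_join L M : countable L -> countable M -> countable (join_labels L M).
Proof.
by move=> cL cM; apply: countableU; apply: card_le_trans (card_image_le _ _) _.
Qed.

Lemma join_subset L M L' M' : L `<=` L' -> M `<=` M' ->
  join_labels L M `<=` join_labels L' M'.
Proof. by move=> LL MM; apply: setUSS; apply: image_subset. Qed.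

End Product.

(** Needed because a product of bisections is the image under multiplication of a Borel subset of
    the square. The coded sets form a sigma-algebra, so it is enough to code preimages under the two
    projections. *)
Lemma lusin_space_prod (d1 d2 : measure_display) (T1 : measurableType d1)
    (T2 : measurableType d2) :
  lusin_space T1 -> lusin_space T2 -> lusin_space (T1 * T2)%type.
Proof.
move=> [L [sL cL coL [l Ll] mL]] [M [sM cM coM [m Mm] mM]].
have sepJ : separating_labels (join_labels L M).
  move=> [x y] [x' y'] e; congr pair.
    by apply: sL => l' Ll'; apply: (e (fun p => l' p.1)); left; exists l'.
  by apply: sM => l' Ll'; apply: (e (fun p => l' p.2)); right; exists l'.
have J0 : join_labels L M !=set0 by exists (fun p => l p.1); left; exists l.
exists (join_labels L M); split=> //; first exact: countable_join.
  exact: complete_join.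
apply: smallest_sub.
  apply: coded_sigma_algebra => //; first exact: countable_join.
  exact: complete_join.
move=> A [[B mB <-]|[B mB <-]]; rewrite setTI.
  have [L' [l' [cL' coL' sub Ll' dec]]] := mL _ mB.
  exists (join_labels L' M), (fun p => l' p.1); split.
  - exact: countable_join.
  - exact: complete_join.
  - exact: join_subset.
  - by left; exists l'.
  - by move=> x y; apply: dec.
have [M' [m' [cM' coM' sub Mm' dec]]] := mM _ mB.
exists (join_labels L M'), (fun p => m' p.2); split.
- exact: countable_join.
- exact: complete_join.
- exact: join_subset.
- by right; exists m'.
- by move=> x y; apply: dec.
Qed.

(** * Borel sets defined by countable quantifiers *)

Section MeasurableForall.
Context {d : measure_display} {Y : measurableType d}.

Lemma measurable_forall (I : countType) (F : I -> set Y) :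
  (forall i, measurable (F i)) -> measurable [set y | forall i, F i y].
Proof.
move=> mF; have -> : [set y | forall i, F i y] = ~` \bigcup_i ~` F i.
  apply/seteqP; split=> [y Fy [i _]|y nFy i]; first by apply.
  by apply: contrapT => nFi; apply: nFy; exists i.
apply: measurableC; apply: countable_bigcupT_measurable; first exact: countableP.
by move=> i; apply: measurableC.
Qed.

Lemma measurable_exists (I : countType) (F : I -> set Y) :
  (forall i, measurable (F i)) -> measurable [set y | exists i, F i y].
Proof.
move=> mF; have -> : [set y | exists i, F i y] = \bigcup_i F i.
  by apply/seteqP; split=> [y [i Fi]|y [i _ Fi]]; exists i.
by apply: countable_bigcupT_measurable; first exact: countableP.
Qed.

Lemma measurable_prop (p : Prop) : measurable [set _ : Y | p].
Proof.
have [hp|np] := pselect p.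
  by rewrite (_ : mkset _ = setT)//; apply/seteqP; split.
by rewrite (_ : mkset _ = set0)//; apply/seteqP; split.
Qed.

Lemma measurable_imply (p : Prop) (E : set Y) :
  measurable E -> measurable [set y | p -> E y].
Proof.
move=> mE; have [hp|np] := pselect p.
  by rewrite (_ : mkset _ = E)//; apply/seteqP; split=> y //=; apply.
by rewrite (_ : mkset _ = setT)//; apply/seteqP; split=> // y _ /np.
Qed.

End MeasurableForall.

Lemma finite_nat_bounded (A : set nat) : finite_set A ->
  exists N, forall n, A n -> (n < N)%N.
Proof.
move=> /finite_seqP[s sE]; rewrite {}sE; exists (\max_(i <- s) i).+1 => n /= ns.
by rewrite ltnS; apply: (@leq_bigmax_seq _ _ (fun=> true) id).
Qed.

(** * Borel separation and injective images *)

Section LusinSouslin.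
Context {d d' : measure_display} {T : measurableType d} {Y : measurableType d'}.
Variables (V : nat -> set Y) (f : T -> Y) (A : set T).
Hypotheses (mV : forall k, measurable (V k)).
Hypothesis (sepV : forall x y, (forall k, V k x <-> V k y) -> x = y).
Hypotheses (finj : forall x y, A x -> A y -> f x = f y -> x = y).
Variable l : nat -> T -> nat.
Hypothesis lcomplete : forall b : nat -> nat,
  (forall N, exists x, forall n, (n < N)%N -> l n x = b n) ->
  exists x, forall n, l n x = b n.
Hypothesis decA : exists n, decides (l n) A.
Hypothesis decV : forall k, exists n, decides (l n) (A `&` f @^-1` (V k)).

Let cyl (s : seq nat) : set T :=
  [set x | A x /\ forall n, (n < size s)%N -> l n x = nth 0%N s n].

Let img s := f @` cyl s.

Let img_rcons s : img s = \bigcup_i img (rcons s i).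
Proof.
apply/seteqP; split=> [_ [x [Ax xs] <-]|_ [i _ [x [Ax xs] <-]]].
  exists (l (size s) x) => //; exists x => //; split=> // n.
  by rewrite size_rcons nth_rcons ltnS leq_eqVlt => /orP[/eqP->|ns];
    rewrite ?ltnn ?eqxx// ns xs.
exists x => //; split=> // n ns; have := xs n; rewrite size_rcons nth_rcons ns.
by apply; apply: leqW.
Qed.

Let separated (B C : set Y) :=
  exists E, [/\ measurable E, B `<=` E & E `&` C = set0].

Let separated_bigcup (B C : nat -> set Y) :
  (forall i j, separated (B i) (C j)) ->
  separated (\bigcup_i B i) (\bigcup_j C j).
Proof.
move=> sep; have /choice[E EP] : forall p : nat * nat, exists E,
    [/\ measurable E, B p.1 `<=` E & E `&` C p.2 = set0] by move=> p; apply: sep.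
exists (\bigcup_i \bigcap_j E (i, j)); split.
- apply: bigcupT_measurable => i; apply: bigcapT_measurable => j.
  by case: (EP (i, j)).
- move=> y [i _ By]; exists i => // j _.
  by case: (EP (i, j)) => _ + _; apply.
- rewrite -subset0 => y [[i _ Ey] [j _ Cy]].
  by case: (EP (i, j)) => _ _ <-; split=> //; apply: Ey.
Qed.

(* A cylinder sequence that is consistent with the labels has a point in its
   intersection, and its value lies in [V k] iff some image of a cylinder of
   the sequence is contained in [V k]. *)
Let branch (S : nat -> seq nat) (b : nat -> nat) :
  (forall m, (m <= size (S m))%N) ->
  (forall m n, (n < size (S m))%N -> nth 0%N (S m) n = b n) ->
  (forall m, img (S m) !=set0) ->
  exists x, [/\ A x, forall n, l n x = b n, forall k, V k (f x) ->
    exists m, img (S m) `<=` V k & forall k, ~ V k (f x) ->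
    exists m, img (S m) `<=` ~` V k].
Proof.
move=> Ssize Sb S0.
have cylb m z : cyl (S m) z -> forall n, (n < m)%N -> l n z = b n.
  move=> [_ zS] n nm; have nS : (n < size (S m))%N by apply: leq_trans (Ssize m).
  by rewrite zS// Sb.
have [x xb] : exists x, forall n, l n x = b n.
  by apply: lcomplete => N; have [_ [z zS _]] := S0 N; exists z; apply: cylb.
have Ax : A x.
  have [n dn] := decA; have [_ [z zS _]] := S0 n.+1; apply: (dn z); last by case: zS.
  by rewrite (cylb _ _ zS)// xb.
exists x; split=> // k Vk; have [n dn] := decV k; exists n.+1 => _ [z zS <-].
  by have [] : (A `&` f @^-1` (V k)) z by apply: (dn x); rewrite ?(cylb _ _ zS)// xb.
move=> Vz; apply: Vk.
have [] : (A `&` f @^-1` (V k)) x; last by [].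
by apply: (dn z); rewrite ?(cylb _ _ zS)// ?xb//; split=> //; case: zS.
Qed.

(** If two images cannot be separated, neither can the images of some pair of children, which yields
    two inseparable branches. Their limit points differ since [s] and [t] do, so their values differ
    by injectivity and some [V k] tells them apart. At a finite level the images then lie in [V k]
    and in its complement: they are separated after all. *)
Let cyl_separated s t : size s = size t -> s <> t -> separated (img s) (img t).
Proof.
move=> sst st; apply: contrapT => nsep.
have /choice[nx nxP] : forall p : seq nat * seq nat, exists q : nat * nat,
    ~ separated (img p.1) (img p.2) ->
    ~ separated (img (rcons p.1 q.1)) (img (rcons p.2 q.2)).
  move=> p; apply: contrapT => /forallNP np; have := np (0, 0)%N.
  move=> /not_implyP[np1 _]; apply: np1; rewrite img_rcons (img_rcons p.2).
  apply: separated_bigcup => i j.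
  by have /not_implyP[_ /contrapT] := np (i, j).
pose S n := iter n (fun p => (rcons p.1 (nx p).1, rcons p.2 (nx p).2)) (s, t).
have Sbad n : ~ separated (img (S n).1) (img (S n).2).
  by elim: n => // n ih; apply: nxP.
have S1size n : size (S n).1 = (size s + n)%N.
  by elim: n => [|n ih]; rewrite ?addn0//= size_rcons ih addnS.
have S2size n : size (S n).2 = (size s + n)%N.
  by elim: n => [|n ih]; rewrite ?addn0//= size_rcons ih addnS.
have S1nth m k n : (n < size (S m).1)%N ->
    nth 0%N (S (m + k)%N).1 n = nth 0%N (S m).1 n.
  elim: k => [|k ih] nm; first by rewrite addn0.
  rewrite addnS /= nth_rcons -/(S _) S1size (leq_trans nm) ?ih// S1size.
  by rewrite leq_add2l leq_addr.
have S2nth m k n : (n < size (S m).2)%N ->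
    nth 0%N (S (m + k)%N).2 n = nth 0%N (S m).2 n.
  elim: k => [|k ih] nm; first by rewrite addn0.
  rewrite addnS /= nth_rcons -/(S _) S2size (leq_trans nm) ?ih// S2size.
  by rewrite leq_add2l leq_addr.
have ltS n : (n < size s + n.+1)%N by rewrite addnS ltnS leq_addl.
have S1b m n : (n < size (S m).1)%N -> nth 0%N (S m).1 n = nth 0%N (S n.+1).1 n.
  move=> nm; case: (leqP m n.+1) => [/subnKC<-|/ltnW/subnKC<-].
    by rewrite S1nth.
  by rewrite S1nth// S1size.
have S2b m n : (n < size (S m).2)%N -> nth 0%N (S m).2 n = nth 0%N (S n.+1).2 n.
  move=> nm; case: (leqP m n.+1) => [/subnKC<-|/ltnW/subnKC<-].
    by rewrite S2nth.
  by rewrite S2nth// S2size.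
have [||m|x [Ax xb Vx nVx]] :=
    @branch (fun m => (S m).1) (fun n => nth 0%N (S n.+1).1 n).
- by move=> m; rewrite S1size leq_addl.
- exact: S1b.
- apply/set0P/eqP => i0; apply: (Sbad m); rewrite i0; exists set0.
  by split=> //; rewrite set0I.
have [||m|y [Ay yb Vy nVy]] :=
    @branch (fun m => (S m).2) (fun n => nth 0%N (S n.+1).2 n).
- by move=> m; rewrite S2size leq_addl.
- exact: S2b.
- apply/set0P/eqP => i0; apply: (Sbad m); rewrite i0; exists setT.
  by split=> //; rewrite setI0.
have xy : f x <> f y.
  move=> fxy; apply: st; apply: (@eq_from_nth _ 0%N) => // n ns.
  have xy : x = y by apply: finj.
  have := xb n; rewrite -(S1b 0%N) ?S1size ?addn0//= => <-.
  by have := yb n; rewrite -(S2b 0%N) ?S2size ?addn0//= => <-; rewrite xy.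
have imgS1 m k : img (S (m + k)%N).1 `<=` img (S m).1.
  move=> _ [z [Az zS] <-]; exists z => //; split=> // n nm.
  by rewrite zS ?S1nth// S1size (leq_trans nm)// S1size leq_add2l leq_addr.
have imgS2 m k : img (S (m + k)%N).2 `<=` img (S m).2.
  move=> _ [z [Az zS] <-]; exists z => //; split=> // n nm.
  by rewrite zS ?S2nth// S2size (leq_trans nm)// S2size leq_add2l leq_addr.
apply: xy; apply: sepV => k; apply: contrapT.
have [Vfx|nVfx] := pselect (V k (f x)); have [Vfy|nVfy] := pselect (V k (f y)).
- by apply; split.
- have [m mV1] := Vx _ Vfx; have [m' mV2] := nVy _ nVfy.
  move=> _; apply: (Sbad (m + m')%N); exists (V k); split=> //.
    exact: subset_trans (imgS1 _ _) mV1.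
  rewrite -subset0 => z [Vz]; rewrite addnC => /imgS2/mV2; exact.
- have [m mV1] := nVx _ nVfx; have [m' mV2] := Vy _ Vfy.
  move=> _; apply: (Sbad (m + m')%N); exists (~` V k); split=> //.
  + exact: measurableC.
  + exact: subset_trans (imgS1 _ _) mV1.
  + by rewrite -subset0 => z [Vz]; rewrite addnC => /imgS2/mV2.
- by apply; split.
Qed.

(** [B s] is a Borel hull of [img s], cut down so that hulls of distinct sequences of equal length
    are disjoint and every inclusion of [img s] in some [V k] or its complement is inherited. A
    point lies in the image iff at every length some [s] has it in the hulls of all its prefixes:
    disjointness makes these sequences cohere into one branch, and the inherited inclusions identify
    the point with the value at the end of the branch. *)
Lemma lusin_souslin_labels : measurable (f @` A).
Proof.
have /choice[W WP] : forall p : seq nat * seq nat, exists E, measurable E /\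
    (size p.1 = size p.2 -> p.1 <> p.2 ->
      img p.1 `<=` E /\ E `&` img p.2 = set0).
  move=> p; have [ps|ps] := pselect (size p.1 = size p.2); last by exists set0.
  have [pp|pp] := pselect (p.1 = p.2); first by exists set0.
  by have [E [mE E1 E2]] := cyl_separated ps pp; exists E.
pose B s : set Y := [set y | (forall t, size s = size t /\ s <> t ->
   W (s, t) y /\ ~ W (t, s) y)] `&`
   ([set y | forall k, (img s `<=` V k -> V k y)] `&`
   ([set y | forall k, (img s `<=` ~` V k -> ~ V k y)] `&` [set y | img s !=set0])).
have mB s : measurable (B s).
  apply: measurableI; last apply: measurableI; last apply: measurableI.
  - apply: measurable_forall => t; apply: measurable_imply.
    by apply: measurableI; [case: (WP (s, t))|apply: measurableC; case: (WP (t, s))].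
  - by apply: measurable_forall => k; apply: measurable_imply.
  - by apply: measurable_forall => k; apply: measurable_imply; apply: measurableC.
  - exact: measurable_prop.
have imgB s : img s `<=` B s.
  move=> y sy; split=> [t [st nst]|]; first split.
  - by have [_ /(_ st nst)[+ _]] := WP (s, t); apply.
  - move=> Wy; have [_ /(_ (esym st) (nesym nst))[_ +]] := WP (t, s).
    by rewrite -subset0; apply; split; [exact: Wy|].
  - split; first by move=> k; apply.
    by split; [move=> k; apply|exists y].
have Bdisj s t y : size s = size t -> B s y -> B t y -> s = t.
  move=> st [Bs _] [Bt _]; apply: contrapT => nst.
  have [Wst _] := Bs t (conj st nst).
  by have [_] := Bt s (conj (esym st) (nesym nst)).
have -> : f @` A = [set y | forall N, exists s,
    ([set _ | size s = N] `&` [set y | forall m, B (take m s) y]) y].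
  apply/seteqP; split=> [_ [x Ax <-] N|y].
    exists (mkseq (l ^~ x) N); split=> /=; first by rewrite size_mkseq.
    move=> m; apply: imgB; exists x => //; split=> // n.
    rewrite size_take size_mkseq => nm.
    have [nm' nN] : (n < m)%N /\ (n < N)%N.
      move: nm; case: ifP => mN nm; first by split=> //; apply: ltn_trans mN.
      by split=> //; apply: leq_trans nm _; rewrite leqNgt mN.
    by rewrite nth_take// nth_mkseq.
  move=> /choice[S SP].
  have Ssize N : size (S N) = N by case: (SP N).
  have StakeB N m : B (take m (S N)) y by case: (SP N) => _; apply.
  have Stake N m : (m <= N)%N -> take m (S N) = S m.
    move=> mN; apply: (@Bdisj _ _ y) => //; first by rewrite size_takel Ssize.
    by have := StakeB m m; rewrite take_oversize ?Ssize.
  have [||m|x [Ax _ Vx nVx]] := @branch S (fun n => nth 0%N (S n.+1) n).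
  - by move=> m; rewrite Ssize.
  - move=> m n; rewrite Ssize => nm; rewrite -(Stake _ _ nm) nth_take//.
  - by have [_ [_ [_]]] := StakeB m m; rewrite take_oversize ?Ssize.
  have BS m : B (S m) y by have := StakeB m m; rewrite take_oversize ?Ssize.
  exists x => //; apply: sepV => k; split=> [/Vx[m mV1]|Vy].
    by have [_ [+ _]] := BS m; apply.
  apply: contrapT => /nVx[m mV2].
  by have [_ [_ [+ _]]] := BS m; move/(_ k mV2).
apply: measurable_forall => N; apply: measurable_exists => s.
apply: measurableI; first exact: measurable_prop.
by apply: measurable_forall.
Qed.

End LusinSouslin.

Theorem lusin_souslin (R : realType) (d d' : measure_display)
    (T : measurableType d) (Y : measurableType d') (A : set T) (f : T -> Y) :
  lusin_space T -> standard_borel R Y -> measurable A -> measurable_fun A f ->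
  set_inj A f -> measurable (f @` A).
Proof.
move=> [L0 [sep _ _ _ mL0]] /standard_borel_separating[V [mV sepV]] mA mf finj.
have [|L [cL coL sub decL]] := @coded_family _ L0
    (fun k => if k is k'.+1 then A `&` f @^-1` (V k') else A) sep.
  by move=> [|k]; apply: mL0 => //; apply: mf.
have [l0 Ll0 dA] := decL 0%N.
have /countable_injP[g gi] := cL.
have /choice[e eP] : forall n, exists l, L l /\ forall l', L l' -> g l' = n -> l' = l.
  move=> n; have [[l [Ll gl]]|nl] := pselect (exists l, L l /\ g l = n).
    by exists l; split=> // l' Ll' gl'; apply: gi; rewrite ?inE// gl.
  by exists l0; split=> // l' Ll' gl'; case: nl; exists l'.
have eg l : L l -> e (g l) = l by move=> Ll; have [_ /(_ l Ll erefl)] := eP (g l).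
have finj' x y : A x -> A y -> f x = f y -> x = y.
  by move=> Ax Ay; apply: finj; rewrite ?inE.
apply: (@lusin_souslin_labels _ _ _ _ V f A mV sepV finj' e).
- move=> b bfin; have [|x xP] := coL (b \o g).
    move=> S fS SL.
    have [N NS] := finite_nat_bounded (finite_image g fS).
    have [x xP] := bfin N; exists x => l Sl; rewrite -(eg _ (SL _ Sl)) xP//=.
      by rewrite eg//; apply: SL.
    by apply: NS; exists l.
  exists x => n; have Len : L (e n) by case: (eP n).
  (* The enumeration [e] may repeat a label. A point realising [b] both at [n] and at [g (e n)]
     shows that [b] takes the same value at these two indices. *)
  have [x' x'P] := bfin (maxn n (g (e n))).+1.
  rewrite xP//= -(x'P (g (e n))) ?ltnS ?leq_maxr// eg// x'P//.
  by rewrite ltnS leq_maxl.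
- by exists (g l0); rewrite eg.
- by move=> k; have [l Ll dl] := decL k.+1; exists (g l); rewrite eg.
Qed.

(** * Groupoids and bisections *)

Section GroupoidAlgebra.
Context {X : Type} (K : groupoid X).
Local Notation A := (arrows K).
Local Notation m := (gmul K).
Local Notation i := (ginv K).
Local Notation s := (src K).
Local Notation r := (rng K).

Lemma ginv_arrow g : A g -> A (i g). Proof. by case: (groupoidP K); auto. Qed.

Lemma ginvK g : A g -> i (i g) = g. Proof. by case: (groupoidP K); auto. Qed.

Lemma gmul_arrow g h : A g -> A h -> s g = r h -> A (m g h).
Proof. by case: (groupoidP K) => _ _ + _ _ _ _ _; apply. Qed.

Lemma src_gmul g h : A g -> A h -> s g = r h -> s (m g h) = s h.
Proof. by case: (groupoidP K) => _ _ _ + _ _ _ _; apply. Qed.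

Lemma rng_gmul g h : A g -> A h -> s g = r h -> r (m g h) = r g.
Proof. by case: (groupoidP K) => _ _ _ _ + _ _ _; apply. Qed.

Lemma gmulA g h k : A g -> A h -> A k -> s g = r h -> s h = r k ->
  m (m g h) k = m g (m h k).
Proof. by case: (groupoidP K) => _ _ _ _ _ + _ _; apply. Qed.

Lemma gmul_src g : A g -> m g (s g) = g.
Proof. by case: (groupoidP K) => _ _ _ _ _ _ + _; apply. Qed.

Lemma gmul_rng g : A g -> m (r g) g = g.
Proof. by case: (groupoidP K) => _ _ _ _ _ _ _ +; apply. Qed.

Lemma src_ginv g : A g -> s (i g) = r g.
Proof. by move=> Ag; rewrite /src ginvK. Qed.

Lemma rng_ginv g : A g -> r (i g) = s g.
Proof. by move=> Ag; rewrite /rng ginvK. Qed.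

Lemma src_arrow g : A g -> A (s g).
Proof.
by move=> Ag; apply: gmul_arrow => //; [exact: ginv_arrow|exact: src_ginv].
Qed.

Lemma rng_arrow g : A g -> A (r g).
Proof.
by move=> Ag; rewrite -src_ginv//; apply: src_arrow; apply: ginv_arrow.
Qed.

Lemma src_src g : A g -> s (s g) = s g.
Proof.
by move=> Ag; rewrite {2}/src src_gmul//; [exact: ginv_arrow|exact: src_ginv].
Qed.

Lemma rng_src g : A g -> r (s g) = s g.
Proof.
move=> Ag; rewrite {1}/src rng_gmul//; [|exact: ginv_arrow|exact: src_ginv].
exact: rng_ginv.
Qed.

Lemma src_rng g : A g -> s (r g) = r g.
Proof.
by move=> Ag; rewrite -src_ginv// src_src//; apply: ginv_arrow.
Qed.

Lemma gmulKV g h : A g -> A h -> s g = r h -> m (i g) (m g h) = h.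
Proof.
move=> Ag Ah gh; rewrite -gmulA ?src_ginv//; last exact: ginv_arrow.
by rewrite -/(src K g) gh gmul_rng.
Qed.

Lemma gmulVK g h : A g -> A h -> s g = s h -> m (m g (i h)) h = g.
Proof.
move=> Ag Ah gh; rewrite gmulA ?src_ginv ?rng_ginv//; last exact: ginv_arrow.
by rewrite -/(src K h) -gh gmul_src.
Qed.

Lemma gmulK g h : A g -> A h -> s g = r h -> m (m g h) (i h) = g.
Proof.
move=> Ag Ah gh; have Ai := ginv_arrow Ah.
by rewrite gmulA ?rng_ginv// -/(rng K h) -gh gmul_src.
Qed.

Lemma unitsE x : units K x <-> A x /\ s x = x.
Proof.
split=> [[g Ag <-]|[Ax sx]]; last by exists x.
by split; [exact: src_arrow|exact: src_src].
Qed.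

Lemma units_arrow x : units K x -> A x. Proof. by case/unitsE. Qed.
Lemma units_src x : units K x -> s x = x. Proof. by case/unitsE. Qed.
Lemma units_rng x : units K x -> r x = x.
Proof. by move=> /unitsE[Ax sx]; rewrite -{1}sx rng_src. Qed.

Lemma src_units g : A g -> units K (s g).
Proof. by move=> Ag; apply/unitsE; split; [exact: src_arrow|exact: src_src]. Qed.

Lemma rng_units g : A g -> units K (r g).
Proof. by move=> Ag; rewrite -src_ginv//; apply: src_units; apply: ginv_arrow. Qed.

Lemma gmul_unitr g x : A g -> units K x -> s g = r x -> m g x = g.
Proof. by move=> Ag ux; rewrite units_rng// => <-; rewrite gmul_src. Qed.

Lemma gmul_unitl g x : A g -> units K x -> s x = r g -> m x g = g.
Proof. by move=> Ag ux; rewrite units_src// => ->; rewrite gmul_rng. Qed.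

(** Unlike [full_semigroup_B] this asks for no measurability, so that it also applies to groupoids
    on bare types, such as a disjoint union of finite groupoids. *)
Definition bisection (a : set X) :=
  [/\ a `<=` A, set_inj a s & set_inj a r].

Lemma set_gmulP (a b : set X) k : set_gmul K a b k <->
  exists g h, [/\ a g, b h, A g & A h] /\ s g = r h /\ m g h = k.
Proof.
split=> [[[g h] [[/= ag bh] [/= Ag Ah gh]] <-]|[g [h [[ag bh Ag Ah] [gh <-]]]]].
  by exists g, h.
by exists (g, h).
Qed.

Lemma bisection_src a g h : bisection a -> a g -> a h -> s g = s h -> g = h.
Proof. by case=> _ inj _ ag ah; apply: inj; rewrite inE. Qed.

Lemma bisection_rng a g h : bisection a -> a g -> a h -> r g = r h -> g = h.
Proof. by case=> _ _ inj ag ah; apply: inj; rewrite inE. Qed.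

Lemma bisectionP a : a `<=` A -> (forall g h, a g -> a h -> s g = s h -> g = h) ->
  (forall g h, a g -> a h -> r g = r h -> g = h) -> bisection a.
Proof. by move=> aA sa ra; split=> // g h; rewrite !inE; auto. Qed.

Lemma bisection_sub a b : a `<=` b -> bisection b -> bisection a.
Proof.
move=> ab bb; apply: bisectionP; first by case: bb => + _ _; apply: subset_trans.
  by move=> g h /ab bg /ab bh; apply: bisection_src bb _ _.
by move=> g h /ab bg /ab bh; apply: bisection_rng bb _ _.
Qed.

Lemma bisection_mul a b : bisection a -> bisection b -> bisection (set_gmul K a b).
Proof.
move=> ba bb; apply: bisectionP.
- by move=> _ /set_gmulP[g [h [[ag bh Ag Ah] [gh <-]]]]; apply: gmul_arrow.
- move=> ? ? /set_gmulP[g [h [[ag bh Ag Ah] [gh <-]]]].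
  move=> /set_gmulP[g' [h' [[ag' bh' Ag' Ah'] [gh' <-]]]]; rewrite !src_gmul// => e.
  have hh : h = h' by apply: (bisection_src bb).
  by rewrite hh (bisection_src ba ag ag')// gh gh' hh.
- move=> ? ? /set_gmulP[g [h [[ag bh Ag Ah] [gh <-]]]].
  move=> /set_gmulP[g' [h' [[ag' bh' Ag' Ah'] [gh' <-]]]]; rewrite !rng_gmul// => e.
  have gg : g = g' by apply: (bisection_rng ba).
  by rewrite gg (bisection_rng bb bh bh')// -gh -gh' gg.
Qed.

Lemma bisection_units e : e `<=` units K -> bisection e.
Proof.
move=> eu; apply: bisectionP; first by move=> x /eu/units_arrow.
  by move=> g h /eu ug /eu uh; rewrite !units_src.
by move=> g h /eu ug /eu uh; rewrite !units_rng.
Qed.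

Lemma src_image_units e : e `<=` units K -> s @` e = e.
Proof.
move=> eu; apply/seteqP; split=> [_ [x ex <-]|x ex]; first by rewrite units_src//; apply: eu.
by exists x => //; rewrite units_src//; apply: eu.
Qed.

Lemma src_image_sub a : a `<=` A -> s @` a `<=` units K.
Proof. by move=> aA _ [g ag <-]; apply: src_units; apply: aA. Qed.

Lemma rng_image_sub a : a `<=` A -> r @` a `<=` units K.
Proof. by move=> aA _ [g ag <-]; apply: rng_units; apply: aA. Qed.

Lemma set_gmul_unitr a e : a `<=` A -> e `<=` units K ->
  set_gmul K a e = [set g | a g /\ e (s g)].
Proof.
move=> aA eu; apply/seteqP; split=> [_ /set_gmulP[g [x [[ag ex Ag Ax] [gx <-]]]]|g [ag eg]].
  have ux := eu _ ex; rewrite /= gmul_unitr//; split=> //.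
  by rewrite gx units_rng.
apply/set_gmulP; exists g, (s g); have Ag := aA _ ag.
by do !split=> //; rewrite ?rng_src ?gmul_src//; apply: src_arrow.
Qed.

Lemma set_gmul_unitl a e : a `<=` A -> e `<=` units K ->
  set_gmul K e a = [set g | a g /\ e (r g)].
Proof.
move=> aA eu; apply/seteqP; split=> [_ /set_gmulP[x [g [[ex ag Ax Ag] [xg <-]]]]|g [ag eg]].
  have ux := eu _ ex; rewrite /= gmul_unitl//; split=> //.
  by rewrite -xg units_src.
apply/set_gmulP; exists (r g), g; have Ag := aA _ ag.
by do !split=> //; rewrite ?src_rng ?gmul_rng//; apply: rng_arrow.
Qed.

End GroupoidAlgebra.

Lemma measurable_fun_pair_on (d d1 d2 : measure_display)
    (T : measurableType d) (T1 : measurableType d1) (T2 : measurableType d2)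
    (D : set T) (f : T -> T1) (g : T -> T2) :
  measurable_fun D f -> measurable_fun D g ->
  measurable_fun D (fun x => (f x, g x)).
Proof.
move=> mf mg mD.
apply: (@measurability _ _ _ _ D (fun x => (f x, g x))
  (preimage_set_system setT fst measurable `|`
   preimage_set_system setT snd measurable)) => //.
by move=> _ [_ [[B mB <-]|[B mB <-]] <-]; rewrite setTI; [exact: mf|exact: mg].
Qed.

(** * Borel bisections and their operations *)

Section Measurability.
Context {R : realType} {d : measure_display} {T : measurableType d}.
Variables (G : groupoid T) (Gd : Defs.discrete_measurable R G).
Local Notation A := (arrows G).
Local Notation B := (full_semigroup_B G).

Lemma full_semigroup_BE a : B a <-> measurable a /\ bisection G a.
Proof. by split=> [[]|[ma []]]. Qed.

Lemma arrows_measurable : measurable A. Proof. by case: Gd. Qed.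

Lemma measurable_src : measurable_fun A (src G).
Proof.
have [_ mA mi mC mm _] := Gd.
apply: (@measurable_comp _ _ _ _ _ _ (composable G) _ _ (fun g => (ginv G g, g))) mm _ => //.
  by move=> _ [g Ag <-]; split=> //=; [exact: ginv_arrow|exact: src_ginv].
by apply: measurable_fun_pair_on => //; apply: measurable_id.
Qed.

Lemma measurable_rng : measurable_fun A (rng G).
Proof.
have [_ mA mi mC mm _] := Gd.
apply: (@measurable_comp _ _ _ _ _ _ (composable G) _ _ (fun g => (g, ginv G g))) mm _ => //.
  move=> _ [g Ag <-]; split=> //=; [exact: ginv_arrow|by rewrite rng_ginv].
by apply: measurable_fun_pair_on => //; apply: measurable_id.
Qed.

(** Units are the arrows with s(g) = g, and this equation is Borel because countably many Borel sets
    [V k] test equality in [T]. *)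
Lemma units_measurable : measurable (units G).
Proof.
have [sb _ _ _ _ _] := Gd.
have -> : units G = A `&` [set g | src G g = g].
  by apply/seteqP; split=> x /unitsE.
have [V [mV sepV]] := standard_borel_separating sb.
have -> : A `&` [set g | src G g = g] = [set g | forall k,
    ((A `&` src G @^-1` (V k)) `&` V k `|` (A `&` src G @^-1` (~` V k)) `&` ~` V k) g].
  apply/seteqP; split=> [g [Ag /= sg] k|g gV].
    by rewrite /= sg; have [|] := pselect (V k g); [left|right].
  have Ag : A g by case: (gV 0%N) => [[[]]|[[]]].
  split=> //=; apply: sepV => k.
  by case: (gV k) => -[[_ /= na] nb].
have mA := arrows_measurable.
apply: measurable_forall => k; apply: measurableU; apply: measurableI => //.
- exact: measurable_src.
- by apply: measurable_src => //; apply: measurableC.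
- exact: measurableC.
Qed.

Lemma fsB_src_measurable a : B a -> measurable (src G @` a).
Proof.
move=> [ma aA sa _]; have [sb _ _ _ _ _] := Gd.
apply: (lusin_souslin (standard_borel_lusin sb) sb ma _ sa).
by apply: (measurable_funS arrows_measurable aA); exact: measurable_src.
Qed.

Lemma fsB_rng_measurable a : B a -> measurable (rng G @` a).
Proof.
move=> [ma aA _ ra]; have [sb _ _ _ _ _] := Gd.
apply: (lusin_souslin (standard_borel_lusin sb) sb ma _ ra).
by apply: (measurable_funS arrows_measurable aA); exact: measurable_rng.
Qed.

(** Multiplication is injective on the composable pairs: the source of the product determines the
    right factor in [b], whose range determines the left factor in [a]. *)
Lemma fsB_mul a b : B a -> B b -> B (set_gmul G a b).
Proof.
move=> /full_semigroup_BE[ma ba] /full_semigroup_BE[mb bb].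
apply/full_semigroup_BE; split; last exact: bisection_mul.
have [sb _ _ mC mm _] := Gd.
have lT := standard_borel_lusin sb.
have mab : measurable ((a `*` b) `&` composable G).
  by apply: measurableI => //; apply: measurableX.
apply: (lusin_souslin (lusin_space_prod lT lT) sb mab).
  by apply: measurable_funS mm => //; apply: subIsetr.
move=> [g h] [g' h']; rewrite !inE => -[[/= ag bh] [/= Ag Ah gh]].
move=> [[/= ag' bh'] [/= Ag' Ah' gh']] e.
have hh : h = h' by apply: (bisection_src bb) => //; rewrite -(src_gmul Ag)// e src_gmul.
by rewrite hh (bisection_src ba ag ag')// gh gh' hh.
Qed.

Lemma fsB_sub a b : measurable a -> a `<=` b -> B b -> B a.
Proof.
move=> ma ab /full_semigroup_BE[_ bb]; apply/full_semigroup_BE; split=> //.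
exact: bisection_sub bb.
Qed.

Lemma fsB_measurable a : B a -> measurable a. Proof. by case. Qed.

Lemma fsB_bisection a : B a -> bisection G a. Proof. by case/full_semigroup_BE. Qed.

Lemma fsB_arrows a : B a -> a `<=` A. Proof. by case. Qed.

Lemma fsB_setI a b : B a -> B b -> B (a `&` b).
Proof.
move=> Ba Bb; apply: (fsB_sub _ _ Ba); last exact: subIsetl.
by apply: measurableI; apply: fsB_measurable.
Qed.

Lemma fsB_setD a b : B a -> B b -> B (a `\` b).
Proof.
move=> Ba Bb; apply: (fsB_sub _ _ Ba); last exact: subDsetl.
by apply: measurableD; apply: fsB_measurable.
Qed.

Lemma fsB_unit e : measurable e -> e `<=` units G -> B e.
Proof. by move=> me eu; apply/full_semigroup_BE; split=> //; apply: bisection_units. Qed.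

Lemma fsB_src a : B a -> B (src G @` a).
Proof.
move=> Ba; apply: fsB_unit; first exact: fsB_src_measurable.
by apply: src_image_sub; apply: fsB_arrows.
Qed.

Lemma fsB_rng a : B a -> B (rng G @` a).
Proof.
move=> Ba; apply: fsB_unit; first exact: fsB_rng_measurable.
by apply: rng_image_sub; apply: fsB_arrows.
Qed.

Lemma fsB_ginv a : B a -> B (A `&` ginv G @^-1` a).
Proof.
move=> Ba; have [ma _ _ _] := Ba; have [_ mA mi _ _ _] := Gd.
apply/full_semigroup_BE; split; first exact: mi.
apply: bisectionP => [|g h|g h]; first by move=> ? [].
  move=> [Ag /= ag] [Ah /= ah] e; rewrite -(ginvK Ag) -(ginvK Ah); congr ginv.
  by apply: (bisection_rng (fsB_bisection Ba)); rewrite ?rng_ginv.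
move=> [Ag /= ag] [Ah /= ah] e; rewrite -(ginvK Ag) -(ginvK Ah); congr ginv.
by apply: (bisection_src (fsB_bisection Ba)); rewrite ?src_ginv.
Qed.

Lemma fsB_set0 : B set0. Proof. by split=> // x y; rewrite inE. Qed.

End Measurability.

Lemma pmp_discrete (R : realType) (d : measure_display) (T : measurableType d)
    (G : groupoid T) (mu : probability T R) :
  pmp_groupoid G mu -> Defs.discrete_measurable R G.
Proof. by case. Qed.

Lemma mu_src_rng (R : realType) (d : measure_display) (T : measurableType d)
    (G : groupoid T) (mu : probability T R) a :
  pmp_groupoid G mu -> full_semigroup_B G a -> mu (src G @` a) = mu (rng G @` a).
Proof. by case=> _ _; apply. Qed.

(** * Subgroupoids of finite index *)

Lemma measure_negligible_diff (R : realType) (d : measure_display)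
    (T : measurableType d) (mu : probability T R) (a b : set T) :
  measurable a -> measurable b -> a `<=` b -> mu.-negligible (b `\` a) ->
  mu a = mu b.
Proof.
move=> ma mb ab n; have mba : measurable (b `\` a) by apply: measurableD.
rewrite -[in RHS](setDUK ab) measureU ?setDIK//.
by rewrite [X in (_ + X)%E]measure_negligible ?adde0.
Qed.

Section FiniteIndex.
Context {R : realType} {d : measure_display} {T : measurableType d}.
Variables (G : groupoid T) (mu : probability T R) (Gpmp : pmp_groupoid G mu).
Variables (H : set T) (HG : is_subgroupoid G H).
Variables (n : nat) (psi : 'I_n -> set T).
Hypothesis psifull : forall i, full_group G mu (psi i).
Hypothesis psicover : mu.-negligible
  (src G @` (arrows G `\` \bigcup_i set_gmul G (psi i) H)).
Hypothesis psidisj : forall i j, i != j -> mu.-negligible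
  (src G @` (set_gmul G (psi i) H `&` set_gmul G (psi j) H)).
Local Notation A := (arrows G).
Local Notation s := (src G).
Local Notation r := (rng G).
Local Notation m := (gmul G).
Local Notation K := (subgroupoid HG).
Local Notation B := (full_semigroup_B G).
Local Notation BH := (full_semigroup_B K).

Let Gd := pmp_discrete Gpmp.
Let HA : H `<=` A. Proof. exact: subgroupoid_sub HG. Qed.
Let Hmul g h : H g -> H h -> s g = r h -> H (m g h).
Proof. exact: subgroupoid_mul HG _ _. Qed.
Let Hinv g : H g -> H (ginv G g). Proof. exact: subgroupoid_inv HG _. Qed.
Let mH : measurable H. Proof. exact: subgroupoid_measurable HG. Qed.
Let psiB i : B (psi i). Proof. by case: (psifull i). Qed.
Let psiA i p : psi i p -> A p. Proof. exact: fsB_arrows (psiB i) _. Qed.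
Let psis i p q : psi i p -> psi i q -> s p = s q -> p = q.
Proof. exact: bisection_src (fsB_bisection (psiB i)). Qed.
Lemma sub_full_semigroup_BE a : BH a <-> B a /\ a `<=` H.
Proof.
by split=> [[ma aH sa ra]|[[ma aA sa ra] aH]]; split=> //; split=> //;
   apply: subset_trans HA.
Qed.

Lemma sub_discrete : Defs.discrete_measurable R K.
Proof.
have [sb mA mi mC mm ct] := Gd; split=> //.
- exact: measurable_funS mi.
- have -> : composable K = composable G `&` (H `*` H).
    apply/seteqP; split=> [[g h] [/= Hg Hh e]|[g h] [[/= Ag Ah e] [/= Hg Hh]]] //.
    by split=> //; split=> //=; apply: HA.
  by apply: measurableI => //; apply: measurableX.
- apply: measurable_funS mm => //; move=> [g h] [/= Hg Hh e].
  by split=> //=; apply: HA.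
- move=> x [g Hg gx]; apply: sub_countable (ct x _).
    by apply: subset_card_le => h [/= Hh <-]; split=> //; apply: HA.
  by exists g => //; apply: HA.
Qed.

(** Negligibility is measured on sources, so exceptional arrows are discarded through [s g]: over a
    good source every arrow factors. *)
Let cover g : A g -> ~ (s @` (A `\` \bigcup_i set_gmul G (psi i) H)) (s g) ->
  exists i p h, [/\ psi i p, H h, s p = r h & m p h = g].
Proof.
move=> Ag ng; have [[i _ /set_gmulP[p [h [[pp Hh _ _] [ph e]]]]]|ncov] :=
  pselect ((\bigcup_i set_gmul G (psi i) H) g); first by exists i, p, h.
by case: ng; exists g.
Qed.

(** An empty family of cosets would make the unit space null. Positivity is what allows division by
    [n] later. *)
Lemma finite_index_gt0 : (0 < n)%N.
Proof.
rewrite lt0n; apply/eqP => n0.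
have [_ mu1 _] := Gpmp.
have : mu (units G) = 0%E.
  apply: measure_negligible; first exact: units_measurable Gd.
  apply: negligibleS psicover => _ [g Ag <-]; exists g => //; split=> // -[i _ _].
  by have := leq_ltn_trans (leq0n i) (ltn_ord i); rewrite n0.
by rewrite mu1 => /eqP; rewrite onee_eq0.
Qed.

(** Almost every unit of [G] lies in [H]: factoring a unit x as p h with h in [H] gives s(h) = x. *)
Lemma sub_pmp : pmp_groupoid K mu.
Proof.
split; first exact: sub_discrete.
- have [_ mu1 _] := Gpmp.
  have muK : measurable (units K) by apply: units_measurable sub_discrete.
  have muG : measurable (units G) by apply: units_measurable Gd.
  have KG : units K `<=` units G by move=> x [g /HA Ag <-]; apply: src_units.
  rewrite -mu1; apply: measure_negligible_diff => //.
  apply: negligibleS psicover => x [/unitsE[Ax sx] nKx]; apply: contrapT => nx.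
  have [|i [p [h [pp Hh ph e]]]] := cover Ax; first by rewrite sx.
  by apply: nKx; exists h => //; rewrite -sx -e src_gmul//; [exact: psiA pp|exact: HA].
- move=> a /sub_full_semigroup_BE[Ba _]; exact: (mu_src_rng Gpmp).
Qed.

(* [cmp i a j] is H intersected with psi_i^-1 a psi_j. *)
Definition cmp i (a : set T) j : set T := [set h | H h /\ exists p x q,
  [/\ psi i p, a x & psi j q] /\
  [/\ s p = r h, s x = r q & m p h = m x q]].

Section Cmp.
Variables (a : set T) (Ba : B a).
Let aA x : a x -> A x. Proof. exact: fsB_arrows Ba x. Qed.
Let as_ x y : a x -> a y -> s x = s y -> x = y.
Proof. exact: bisection_src (fsB_bisection Ba). Qed.
Let ar x y : a x -> a y -> r x = r y -> x = y.
Proof. exact: bisection_rng (fsB_bisection Ba). Qed.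

Lemma cmp_src i j h p x q : H h -> psi i p -> a x -> psi j q ->
  s p = r h -> s x = r q -> m p h = m x q -> s h = s q /\ r p = r x.
Proof.
move=> Hh /psiA Ap /aA Ax /psiA Aq ph xq e; have Ah := HA Hh; split.
  by rewrite -(src_gmul Ap Ah ph) e src_gmul.
by rewrite -(rng_gmul Ap Ah ph) e rng_gmul.
Qed.

(** Solving p h = x q for h writes the block as the intersection of [H] with a product of three
    Borel bisections, which is Borel by [fsB_mul]. *)
Lemma cmp_B i j : BH (cmp i a j).
Proof.
have -> : cmp i a j = H `&` set_gmul G (A `&` ginv G @^-1` (psi i)) (set_gmul G a (psi j)).
  apply/seteqP; split=> h.
    move=> [Hh [p [x [q [[pp ax pq] [ph xq e]]]]]]; split=> //.
    have [Ap Ax Aq Ah] := And4 (psiA pp) (aA ax) (psiA pq) (HA Hh).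
    apply/set_gmulP; exists (ginv G p), (m x q); split; first split.
    - by split; [exact: ginv_arrow|rewrite /= ginvK].
    - by apply/set_gmulP; exists x, q.
    - exact: ginv_arrow.
    - exact: gmul_arrow.
    - by rewrite src_ginv// -e rng_gmul// gmulKV.
  move=> [Hh /set_gmulP[p' [y [[[Ap' /= pp'] xqy _ Axq] [pxq e]]]]].
  move: xqy => /set_gmulP[x [q [[ax pq Ax Aq] [xq yE]]]]; subst y.
  split=> //; exists (ginv G p'), x, q; split=> //.
  split=> //; first by rewrite src_ginv// -e rng_gmul.
  by rewrite -e gmulKV.
apply/sub_full_semigroup_BE; split; last by move=> ? [].
have Bm : B (set_gmul G (A `&` ginv G @^-1` (psi i)) (set_gmul G a (psi j))).
  by apply: (fsB_mul Gd); [exact: (fsB_ginv Gd)|exact: (fsB_mul Gd)].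
apply: (fsB_sub _ (@subIsetr _ _ _) Bm).
by apply: measurableI => //; apply: fsB_measurable Bm.
Qed.

(** A common source determines q in psi_j and then x in [a]; the arrow x q, with this same source,
    lies in both psi_i H and psi_i' H. *)
Lemma cmp_src_disj i i' j : i != i' ->
  mu (s @` cmp i a j `&` s @` cmp i' a j) = 0%E.
Proof.
move=> ii; apply: measure_negligible.
  by apply: measurableI; apply: (fsB_src_measurable sub_discrete); apply: cmp_B.
apply: negligibleS (psidisj ii) => _ [[h [Hh [p [x [q [[pp ax pq] [ph xq e]]]]]] <-]].
move=> [h' [Hh' [p' [x' [q' [[pp' ax' pq'] [ph' xq' e']]]]]] hh].
have [hq px] := cmp_src Hh pp ax pq ph xq e.
have [hq' px'] := cmp_src Hh' pp' ax' pq' ph' xq' e'.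
have qq : q = q' by apply: (psis pq pq'); rewrite -hq -hq' hh.
have xx : x = x' by apply: as_ => //; rewrite xq xq' qq.
have [Ap Ap' Ah Ah'] := And4 (psiA pp) (psiA pp') (HA Hh) (HA Hh').
exists (m p h); last by rewrite src_gmul.
split; apply/set_gmulP; first by exists p, h.
by exists p', h'; do !split=> //; rewrite e e' qq xx.
Qed.

(** A common range determines p in psi_i and then x in [a]. The arrow x^-1 p equals both q h^-1 and
    q' h'^-1, so it lies in psi_j H and in psi_j' H, and its source is the common range. *)
Lemma cmp_rng_disj i j j' : j != j' ->
  mu (r @` cmp i a j `&` r @` cmp i a j') = 0%E.
Proof.
move=> jj; apply: measure_negligible.
  by apply: measurableI; apply: (fsB_rng_measurable sub_discrete); apply: cmp_B.
apply: negligibleS (psidisj jj) => _ [[h [Hh [p [x [q [[pp ax pq] [ph xq e]]]]]] <-]].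
move=> [h' [Hh' [p' [x' [q' [[pp' ax' pq'] [ph' xq' e']]]]]] hh].
have [hq px] := cmp_src Hh pp ax pq ph xq e.
have [hq' px'] := cmp_src Hh' pp' ax' pq' ph' xq' e'.
have p_eq : p = p' by apply: (psis pp pp'); rewrite ph ph' hh.
have xx : x = x' by apply: ar => //; rewrite -px -px' p_eq.
have [Ax Ap Ah Ah'] := And4 (aA ax) (psiA pp) (HA Hh) (HA Hh').
have [Aq Aq'] := conj (psiA pq) (psiA pq').
have E : m (ginv G x) p = m q (ginv G h).
  have xp : s (ginv G x) = r p by rewrite src_ginv.
  have Aix := ginv_arrow Ax.
  have -> : m q (ginv G h) = m (m (ginv G x) (m x q)) (ginv G h) by rewrite gmulKV.
  rewrite -e gmulA ?rng_ginv ?src_gmul ?gmulK//.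
  + exact: gmul_arrow.
  + exact: ginv_arrow.
  + by rewrite rng_gmul.
have E' : m (ginv G x) p = m q' (ginv G h').
  have xp : s (ginv G x) = r p by rewrite src_ginv.
  have Aix := ginv_arrow Ax.
  have -> : m q' (ginv G h') = m (m (ginv G x) (m x q')) (ginv G h').
    by rewrite gmulKV// xx.
  rewrite xx -e' -p_eq -xx.
  rewrite gmulA ?rng_ginv ?src_gmul ?gmulK// ?p_eq//.
  + by apply: gmul_arrow; rewrite // -p_eq.
  + exact: ginv_arrow.
  + by rewrite rng_gmul// -?p_eq.
exists (m q (ginv G h)); last first.
  by rewrite src_gmul ?rng_ginv ?src_ginv//; apply: ginv_arrow.
split; apply/set_gmulP.
  exists q, (ginv G h); do !split=> //; [exact: Hinv|exact: ginv_arrow|].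
  by rewrite rng_ginv.
exists q', (ginv G h'); do !split=> //; [exact: Hinv|exact: ginv_arrow| |].
  by rewrite rng_ginv.
by rewrite -E' E.
Qed.

End Cmp.

(** The arrows of psi_j used for h and for k have the same source, hence coincide; then p h k = x q
    k = x y t. *)
Lemma cmp_gmul_sub a b i j l : B a -> B b ->
  set_gmul K (cmp i a j) (cmp j b l) `<=` cmp i (set_gmul G a b) l.
Proof.
move=> Ba Bb ? /set_gmulP[h [k [[]]]].
move=> [Hh [p [x [q [[pp ax pq] [ph xq e]]]]]].
move=> [Hk [q' [y [t [[pq' by_ pt] [qk yt e']]]]]] _ _ [hk0 <-].
have hk : s h = r k := hk0.
split; first exact: Hmul.
have [Ap Ah Ak Ax] := And4 (psiA pp) (HA Hh) (HA Hk) (fsB_arrows Ba ax).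
have [Aq At Ay Aq'] := And4 (psiA pq) (psiA pt) (fsB_arrows Bb by_) (psiA pq').
have qq : q = q'.
  by apply: (psis pq pq'); rewrite qk -hk -(src_gmul Ap Ah ph) e src_gmul.
have xy : s x = r y by rewrite xq qq -(rng_gmul Aq' Ak qk) e' rng_gmul.
exists p, (m x y), t; split; first split=> //.
  by apply/set_gmulP; exists x, y.
split.
- by rewrite rng_gmul.
- by rewrite src_gmul.
- have qk' : s q = r k by rewrite qq.
  by rewrite -gmulA// e gmulA// qq e' -gmulA.
Qed.

(** From p h = x y t, factor y t = q k with q in some psi_j and k in [H]. Then k lies in the (j, l)
    block of [b], h k^-1 in the (i, j) block of [a], and h is their product. *)
Lemma cmp_gmul_cover a b i l : B a -> B b -> mu (s @` (cmp i (set_gmul G a b) l `\`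
  \bigcup_j set_gmul K (cmp i a j) (cmp j b l))) = 0%E.
Proof.
move=> Ba Bb; have Bab := fsB_mul Gd Ba Bb.
apply: measure_negligible.
  apply: (fsB_src_measurable sub_discrete).
  have BHab := cmp_B Bab i l.
  apply: (fsB_sub _ (@subDsetl _ _ _) BHab); apply: measurableD; first exact: fsB_measurable BHab.
  apply: fin_bigcup_measurable => // j _; apply: fsB_measurable.
  by apply: (fsB_mul sub_discrete); apply: cmp_B.
apply: negligibleS psicover => _ [h [[Hh [p [z [t [[pp xyz pt] [ph xyt e]]]]]] nh] <-].
move: xyz => /set_gmulP[x [y [[ax by_ Ax Ay] [xy zE]]]]; subst z.
apply: contrapT => nsh; apply: nh.
have [Ap Ah At] := And3 (psiA pp) (HA Hh) (psiA pt).
have yt : s y = r t by rewrite -xyt src_gmul.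
have Ayt := gmul_arrow Ay At yt.
have sht : s h = s t by rewrite -(src_gmul Ap Ah ph) e src_gmul//; apply: gmul_arrow.
have [|j [q [k [pq Hk qk ek]]]] := cover Ayt; first by rewrite src_gmul// -sht.
have [Aq Ak] := conj (psiA pq) (HA Hk).
have hk : s h = s k by rewrite sht -(src_gmul Ay At yt) -ek src_gmul.
have Aik := ginv_arrow Ak.
have hik : s h = r (ginv G k) by rewrite rng_ginv.
have xq : s x = r q by rewrite xy -(rng_gmul Ay At yt) -ek rng_gmul.
exists j => //; apply/set_gmulP; exists (m h (ginv G k)), k; split; first split.
- split; first by apply: Hmul => //; apply: Hinv.
  exists p, x, q; split=> //; split=> //; first by rewrite rng_gmul.
  rewrite -gmulA// e (gmulA Ax Ay At)// -ek -(gmulA Ax Aq Ak)//.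
  by rewrite gmulK ?src_gmul//; apply: gmul_arrow.
- by split=> //; exists q, y, t.
- by apply: Hmul => //; apply: Hinv.
- by [].
- split; last exact: (@gmulVK _ G).
  by have : s (m h (ginv G k)) = r k by rewrite src_gmul// src_ginv.
Qed.

(** Let [Q] be the part of psi_j with range in [E]. Up to a null set the union [W] is s(Q), since
    for q in [Q] the arrow x q lies in some coset psi_i H and so gives an h with the source of q.
    Invariance of the measure turns s(Q) into r(Q), and r(Q) is almost all of [E] as psi_j has
    conull range. *)
Lemma cmp_dist a b j : B a -> B b ->
  mu (\bigcup_i s @` (cmp i a j `+` cmp i b j)) = mu (s @` (a `+` b)).
Proof.
move=> Ba Bb.
have mS (c e : set T) : B c -> B e -> measurable (s @` (c `+` e)).
  move=> Bc Be; rewrite setY_def image_setU; apply: measurableU.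
    by apply: (fsB_src_measurable Gd); apply: fsB_setD.
  by apply: (fsB_src_measurable Gd); apply: fsB_setD.
set W := \bigcup_i _; set E := s @` (a `+` b).
have mE : measurable E by apply: mS.
have mW : measurable W.
  apply: fin_bigcup_measurable => // i _; apply: mS.
    by have /sub_full_semigroup_BE[] := cmp_B Ba i j.
  by have /sub_full_semigroup_BE[] := cmp_B Bb i j.
pose Q := psi j `&` r @^-1` E.
have BQ : B Q.
  apply: (fsB_sub _ (@subIsetl _ _ _) (psiB j)).
  have QE : Q = psi j `&` (A `&` r @^-1` E).
    by apply/seteqP; split=> q [pq]; [split=> //; split=> //; apply: psiA pq|case].
  rewrite -/Q QE.
  apply: measurableI; first exact: fsB_measurable (psiB j).
  by apply: (measurable_rng Gd) => //; apply: arrows_measurable Gd.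
have WQ : W `<=` s @` Q.
  have half c e i h : B c -> B e -> c `\` e `<=` a `+` b ->
      cmp i c j h -> ~ cmp i e j h -> (s @` Q) (s h).
    move=> Bc Be sub [Hh [p [x [q [[pp cx pq] [ph xq e1]]]]]] ne.
    have [hq px] := cmp_src Bc Hh pp cx pq ph xq e1.
    exists q => //; split=> //=; exists x => //; apply: sub; split=> // ex.
    by apply: ne; split=> //; exists p, x, q.
  move=> _ [i _ [h [[ah bh]|[bh ah]] <-]].
    by apply: (half a b i h) => // x ?; left.
  by apply: (half b a i h) => // x ?; right.
have mQ : measurable (s @` Q) by apply: (fsB_src_measurable Gd).
have QW : s @` Q `\` W `<=` s @` (A `\` \bigcup_i set_gmul G (psi i) H).
  have half c e q x : B c -> B e -> c x -> ~ e x -> psi j q -> s x = r q ->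
      ~ (s @` (A `\` \bigcup_i set_gmul G (psi i) H)) (s q) ->
      exists i h, [/\ cmp i c j h, ~ cmp i e j h & s h = s q].
    move=> Bc Be cx nex pq xq nq.
    have [Ax Aq] := conj (fsB_arrows Bc cx) (psiA pq).
    have [|i [p [h [pp Hh ph xqe]]]] := cover (gmul_arrow Ax Aq xq).
      by rewrite src_gmul.
    have [Ap Ah] := conj (psiA pp) (HA Hh).
    have hq : s h = s q by rewrite -(src_gmul Ap Ah ph) xqe src_gmul.
    exists i, h; split=> //; first by split=> //; exists p, x, q.
    (* If h were also in the block of [e], through p', y and q', injectivity of sources would give
       q' = q and p' = p, and cancelling q would give y = x. *)
    move=> [_ [p' [y [q' [[pp' ey pq'] [ph' yq' e']]]]]]; apply: nex.
    have [hq' _] := cmp_src Be Hh pp' ey pq' ph' yq' e'.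
    have qq : q = q' by apply: (psis pq pq'); rewrite -hq.
    have pe : p = p' by apply: (psis pp pp'); rewrite ph.
    have Ay := fsB_arrows Be ey.
    suff -> : x = y by [].
    by rewrite -(gmulK Ax Aq xq) -xqe pe e' -qq gmulK// qq.
  move=> _ [[q [pq [x xab xq]] <-] nW]; apply: contrapT => nq; apply: nW.
  case: xab => -[cx nex].
    have [i [h [ch neh <-]]] := half a b q x Ba Bb cx nex pq xq nq.
    by exists i => //; exists h => //; left.
  have [i [h [ch neh <-]]] := half b a q x Bb Ba cx nex pq xq nq.
  by exists i => //; exists h => //; right.
have -> : mu W = mu (s @` Q).
  by apply: measure_negligible_diff => //; apply: negligibleS QW _.
rewrite (mu_src_rng Gpmp BQ); apply: measure_negligible_diff => //.
- exact: (fsB_rng_measurable Gd).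
- by move=> _ [q [_ ?] <-].
have [_ _ nr] := psifull j; apply: negligibleS nr => x [Ex nx].
split; last by move=> [q pq qx]; apply: nx; exists q => //; split=> //; rewrite /= qx.
apply: src_image_sub Ex => y [] [+ _]; exact: fsB_arrows.
Qed.

End FiniteIndex.

(** * Embeddings into groupoids with a finitely additive measure *)

(** Finite additivity on all subsets is what survives an ultralimit. The bound by 1 ensures
    convergence along the ultrafilter and drives the argument of [emb_set0]. *)
Record mean_groupoid (R : realType) (X : Type) (K : groupoid X)
    (lam : set X -> R) : Prop := MeanGroupoid {
  mean_ge0 : forall E, 0 <= lam E;
  meanU : forall E F, E `&` F = set0 -> lam (E `|` F) = lam E + lam F;
  mean_le1 : forall E, lam E <= 1;
  mean_inv : forall a, bisection K a -> lam (src K @` a) = lam (rng K @` a)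
}.

Section MeanGroupoid.
Context {R : realType} {X : Type} (K : groupoid X) (lam : set X -> R).
Hypothesis Klam : mean_groupoid K lam.
Local Notation A := (arrows K).
Local Notation s := (src K).
Local Notation r := (rng K).

Lemma mean_split E F : lam E = lam (E `&` F) + lam (E `\` F).
Proof.
rewrite -(meanU Klam) ?setUIDK//.
by rewrite setIDA -subset0 => x [[[]]].
Qed.

Lemma mean0 : lam set0 = 0.
Proof.
have := meanU Klam (setI0 set0); rewrite setU0 => /eqP.
by rewrite -subr_eq0 opprD addNKr oppr_eq0 => /eqP.
Qed.

Lemma mean_mono E F : E `<=` F -> lam E <= lam F.
Proof.
move=> EF; rewrite (mean_split F E) setIC.
by have /setIidl -> := EF; rewrite lerDl (mean_ge0 Klam).
Qed.

Lemma mean_subadd E F : lam (E `|` F) <= lam E + lam F.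
Proof.
rewrite (mean_split (E `|` F) E); apply: lerD; apply: mean_mono.
  exact: subIsetr.
by move=> x [[|//]].
Qed.

Lemma mean_modular E F : lam (E `|` F) + lam (E `&` F) = lam E + lam F.
Proof.
rewrite (mean_split (E `|` F) E) (mean_split F E).
have -> : (E `|` F) `&` E = E by apply/seteqP; split=> x /=; tauto.
have -> : (E `|` F) `\` E = F `\` E by apply/seteqP; split=> x /=; tauto.
by rewrite [F `&` E]setIC -addrA [lam (F `\` E) + _]addrC.
Qed.

(* A set of arrows is negligible when its set of sources is; for subsets of a
   bisection this agrees with the notion defined through ranges. *)
Definition null (Y : set X) := lam (s @` Y) = 0.
Definition subn (Y Z : set X) := null (Y `\` Z).
Definition eqn (Y Z : set X) := subn Y Z /\ subn Z Y.

Lemma nullE Y : null Y = (lam (s @` Y) = 0). Proof. by []. Qed.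

Lemma subnE Y Z : subn Y Z = null (Y `\` Z). Proof. by []. Qed.

Lemma mean_null_sub E F : E `<=` F -> lam F = 0 -> lam E = 0.
Proof.
move=> EF F0; apply/eqP; rewrite eq_le (mean_ge0 Klam) andbT -F0.
exact: mean_mono.
Qed.

Lemma mean_nullU E F : lam E = 0 -> lam F = 0 -> lam (E `|` F) = 0.
Proof.
move=> E0 F0; apply/eqP; rewrite eq_le (mean_ge0 Klam) andbT.
by apply: le_trans (mean_subadd _ _) _; rewrite E0 F0 addr0.
Qed.

Lemma null_sub Y Z : Y `<=` Z -> null Z -> null Y.
Proof. by move=> YZ; apply: mean_null_sub; apply: image_subset. Qed.

Lemma nullU Y Z : null Y -> null Z -> null (Y `|` Z).
Proof. by rewrite /null image_setU; apply: mean_nullU. Qed.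

Lemma null_set0 : null set0.
Proof. by rewrite /null image_set0 mean0. Qed.

Lemma null_bigcup (I : finType) (F : I -> set X) :
  (forall i, null (F i)) -> null (\bigcup_i F i).
Proof.
move=> F0; suff : forall t : seq I, null [set x | exists2 i, i \in t & F i x].
  by move=> /(_ (enum I)); apply: null_sub => x [i _ Fx]; exists i; rewrite ?mem_enum.
elim=> [|j t ih]; first by apply: null_sub null_set0 => x [].
apply: null_sub (nullU (F0 j) ih) => x [i]; rewrite inE => /orP[/eqP->|it Fx].
  by left.
by right; exists i.
Qed.

Lemma subset_subn Y Z : Y `<=` Z -> subn Y Z.
Proof. by move=> YZ; apply: null_sub null_set0 => x [/YZ]. Qed.

Lemma subn_trans Y Z W : subn Y Z -> subn Z W -> subn Y W.
Proof.
move=> YZ ZW; apply: null_sub (nullU YZ ZW) => x [Yx nW].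
by have [Zx|nZ] := pselect (Z x); [right|left].
Qed.

Lemma subnU Y Y' Z Z' : subn Y Y' -> subn Z Z' -> subn (Y `|` Z) (Y' `|` Z').
Proof.
by move=> YY ZZ; apply: null_sub (nullU YY ZZ) => x /=; rewrite /setD /=; tauto.
Qed.

Lemma subnI Y Y' Z Z' : subn Y Y' -> subn Z Z' -> subn (Y `&` Z) (Y' `&` Z').
Proof.
move=> YY ZZ; apply: null_sub (nullU YY ZZ) => x [[Yx Zx] n].
have [Yx'|nY] := pselect (Y' x); last by left.
by right; split=> // Zx'; apply: n.
Qed.

Lemma subnD Y Y' Z Z' : subn Y Y' -> subn Z' Z -> subn (Y `\` Z) (Y' `\` Z').
Proof.
move=> YY ZZ; apply: null_sub (nullU YY ZZ) => x [[Yx nZ] n].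
have [Yx'|nY] := pselect (Y' x); last by left.
by right; split=> //; apply: contrapT => nZ'; apply: n.
Qed.

Lemma subn_bigcup (I : finType) (F F' : I -> set X) :
  (forall i, subn (F i) (F' i)) -> subn (\bigcup_i F i) (\bigcup_i F' i).
Proof.
move=> FF; apply: null_sub (null_bigcup FF) => x [[i _ Fx] n].
by exists i => //; split=> // Fx'; apply: n; exists i.
Qed.

Lemma eqn_sym Y Z : eqn Y Z -> eqn Z Y.
Proof. by case. Qed.

Lemma eqn_trans Y Z W : eqn Y Z -> eqn Z W -> eqn Y W.
Proof. by move=> [YZ ZY] [ZW WZ]; split; [apply: subn_trans ZW|apply: subn_trans ZY]. Qed.

Lemma eqnU Y Y' Z Z' : eqn Y Y' -> eqn Z Z' -> eqn (Y `|` Z) (Y' `|` Z').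
Proof. by move=> [? ?] [? ?]; split; apply: subnU. Qed.

Lemma eqnI Y Y' Z Z' : eqn Y Y' -> eqn Z Z' -> eqn (Y `&` Z) (Y' `&` Z').
Proof. by move=> [? ?] [? ?]; split; apply: subnI. Qed.

Lemma eqnD Y Y' Z Z' : eqn Y Y' -> eqn Z Z' -> eqn (Y `\` Z) (Y' `\` Z').
Proof. by move=> [? ?] [? ?]; split; apply: subnD. Qed.

Lemma eqn_bigcup (I : finType) (F F' : I -> set X) :
  (forall i, eqn (F i) (F' i)) -> eqn (\bigcup_i F i) (\bigcup_i F' i).
Proof. by move=> FF; split; apply: subn_bigcup => i; case: (FF i). Qed.

Lemma subn_src Y Z : Y `<=` A -> subn Y Z -> subn (s @` Y) (s @` Z).
Proof.
move=> YA; apply: mean_null_sub => _ [_ [[g Yg <-] n] <-].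
rewrite src_src; last exact: YA.
by exists g => //; split=> // Zg; apply: n; exists g.
Qed.

Lemma eqn_src Y Z : Y `<=` A -> Z `<=` A -> eqn Y Z -> eqn (s @` Y) (s @` Z).
Proof. by move=> YA ZA [YZ ZY]; split; apply: subn_src. Qed.

Lemma subn_mean Y Z : subn Y Z -> lam (s @` Y) <= lam (s @` Z).
Proof.
move=> YZ; rewrite -[leRHS]addr0 -[X in _ <= _ + X]YZ.
apply: le_trans (mean_subadd _ _); apply: mean_mono; rewrite -image_setU.
by apply: image_subset => x Yx; have [Zx|nZ] := pselect (Z x); [left|right].
Qed.

Lemma eqn_mean Y Z : eqn Y Z -> lam (s @` Y) = lam (s @` Z).
Proof. by move=> [YZ ZY]; apply/eqP; rewrite eq_le !subn_mean. Qed.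

Lemma subn_null Y Z : subn Y Z -> null Z -> null Y.
Proof.
move=> YZ Z0; apply/eqP; rewrite eq_le (mean_ge0 Klam) andbT -Z0.
exact: subn_mean.
Qed.

Lemma bisection_srcD Y Z : bisection K Y -> Z `<=` Y ->
  s @` (Y `\` Z) = s @` Y `\` s @` Z.
Proof.
move=> bY ZY; apply/seteqP; split=> [_ [g [Yg nZ] <-]|_ [[g Yg <-] n]].
  split; first by exists g.
  move=> [h Zh hg]; apply: nZ; suff -> : g = h by [].
  by apply: (bisection_src bY) => //; apply: ZY.
by exists g => //; split=> // Zg; apply: n; exists g.
Qed.

(** Turns comparisons of measures into inclusions modulo null sets. As [Z] is a bisection, the
    sources of [Z] outside [Y] are exactly those left after removing the sources of the
    intersection, so their measure is a difference. *)
Lemma subn_rev Y Z : bisection K Z -> subn Y Z ->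
  lam (s @` Z) <= lam (s @` Y) -> subn Z Y.
Proof.
move=> bZ YZ ZY; apply/eqP; rewrite eq_le (mean_ge0 Klam) andbT.
have -> : Z `\` Y = Z `\` (Y `&` Z) by apply/seteqP; split=> x /=; tauto.
have sub : s @` (Y `&` Z) `<=` s @` Z by apply: image_subset; apply: subIsetr.
have : lam (s @` Y) <= lam (s @` (Y `&` Z)).
  apply: subn_mean; apply: (null_sub _ (YZ : null (Y `\` Z))) => x [Yx nYZ].
  by split=> // Zx; apply: nYZ.
rewrite (bisection_srcD bZ (@subIsetr _ Y Z)).
move=> h; have := mean_split (s @` Z) (s @` (Y `&` Z)).
rewrite setIC; have /setIidl -> := sub; lra.
Qed.

Lemma null_preim_rng Y E : bisection K Y -> lam E = 0 -> null (Y `&` r @^-1` E).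
Proof.
move=> bY E0; rewrite /null (mean_inv Klam).
  by apply: mean_null_sub E0 => _ [g [_ ?] <-].
exact: bisection_sub (@subIsetl _ _ _) bY.
Qed.

(** A product g h is lost because of h, whose source is that of the product, or because of g. In the
    second case r(h) = s(g) lies in a null set, and invariance along [Z] makes the corresponding
    sources null. *)
Lemma subn_mul Y Y' Z Z' : bisection K Z -> subn Y Y' -> subn Z Z' ->
  subn (set_gmul K Y Z) (set_gmul K Y' Z').
Proof.
move=> bZ YY ZZ; have ZY := null_preim_rng bZ YY.
apply: mean_null_sub (mean_nullU ZY ZZ).
move=> _ [_ [/set_gmulP[g [h [[Yg Zh Ag Ah] [gh <-]]]] n] <-].
rewrite src_gmul//; have [Yg'|nY] := pselect (Y' g).
  right; exists h => //; split=> // Zh'; apply: n.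
  by apply/set_gmulP; exists g, h.
by left; exists h => //; split=> //=; exists g.
Qed.

Lemma eqn_mul Y Y' Z Z' : bisection K Z -> bisection K Z' -> eqn Y Y' -> eqn Z Z' ->
  eqn (set_gmul K Y Z) (set_gmul K Y' Z').
Proof. by move=> bZ bZ' [? ?] [? ?]; split; apply: subn_mul. Qed.

End MeanGroupoid.

Section BisectionDistance.
Context {X : Type} (K : groupoid X).
Local Notation s := (src K).

Lemma bisection_srcY a b : bisection K a -> bisection K b ->
  s @` (a `+` b) = (s @` a `|` s @` b) `\` s @` (a `&` b).
Proof.
move=> ba bb; rewrite setY_def image_setU.
have -> : a `\` b = a `\` (a `&` b) by apply/seteqP; split=> x /=; tauto.
have -> : b `\` a = b `\` (a `&` b) by apply/seteqP; split=> x /=; tauto.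
rewrite (bisection_srcD ba (@subIsetl _ a b)) (bisection_srcD bb (@subIsetr _ a b)).
by apply/seteqP; split=> x /=; rewrite /setU /setD /=; tauto.
Qed.

End BisectionDistance.

Record mean_embedding (R : realType) (d : measure_display)
    (T : measurableType d) (G : groupoid T) (mu : probability T R)
    (X : Type) (K : groupoid X) (lam : set X -> R) (f : set T -> set X) : Prop :=
  MeanEmbedding {
    embB : forall a, full_semigroup_B G a -> bisection K (f a);
    emb_dist : forall a b, full_semigroup_B G a -> full_semigroup_B G b ->
      lam (src K @` (f a `+` f b)) = fine (mu (src G @` (a `+` b)));
    emb_mul : forall a b, full_semigroup_B G a -> full_semigroup_B G b ->
      eqn K lam (f (set_gmul G a b)) (set_gmul K (f a) (f b))
  }.

Section RealProbability.
Context {R : realType} {d : measure_display} {T : measurableType d}.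
Variable mu : probability T R.
Local Notation pr E := (fine (mu E)).

Lemma probU (E F : set T) : measurable E -> measurable F -> E `&` F = set0 ->
  pr (E `|` F) = pr E + pr F.
Proof. by move=> mE mF EF; rewrite measureU// fineD//; apply: fin_num_measure. Qed.

Lemma prob_split (E F : set T) : measurable E -> measurable F ->
  pr E = pr (E `&` F) + pr (E `\` F).
Proof.
move=> mE mF; rewrite -probU ?setUIDK//.
- exact: measurableI.
- exact: measurableD.
- by rewrite setIDA -subset0 => x [[[]]].
Qed.

Lemma prob_modular (E F : set T) : measurable E -> measurable F ->
  pr (E `|` F) + pr (E `&` F) = pr E + pr F.
Proof.
move=> mE mF; rewrite (@prob_split (E `|` F) E)//; last exact: measurableU.
rewrite (@prob_split F E)//.
have -> : (E `|` F) `&` E = E by apply/seteqP; split=> x /=; tauto.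
have -> : (E `|` F) `\` E = F `\` E by apply/seteqP; split=> x /=; tauto.
by rewrite [F `&` E]setIC -addrA [pr (F `\` E) + _]addrC.
Qed.

Lemma prob_ge0 (E : set T) : 0 <= pr E.
Proof. by apply: fine_ge0; apply: measure_ge0. Qed.

End RealProbability.

(** * Compatibility of an embedding with set operations *)

Section MeanEmbedding.
Context {R : realType} {X : Type} (K : groupoid X) (lam : set X -> R).
Hypothesis Klam : mean_groupoid K lam.
Context {d : measure_display} {T : measurableType d}.
Variables (G : groupoid T) (mu : probability T R) (Gpmp : pmp_groupoid G mu).
Variable f : set T -> set X.
Hypothesis fE : mean_embedding G mu K lam f.
Local Notation B := (full_semigroup_B G).
Local Notation null := (null K lam).
Local Notation subn := (subn K lam).
Local Notation eqn := (eqn K lam).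
Local Notation pr E := (fine (mu E)).
Local Notation s := (src K).
Local Notation r := (rng K).
Local Notation U := (units K).

Let Gd := pmp_discrete Gpmp.
Let fB a : B a -> bisection K (f a). Proof. exact: embB fE _. Qed.
Let fA a : B a -> f a `<=` arrows K. Proof. by move=> /fB[]. Qed.
Let Be e : measurable e -> e `<=` units G -> B e. Proof. exact: fsB_unit. Qed.
Let unit_gmul e e' : e `<=` units G -> e' `<=` units G -> set_gmul G e e' = e `&` e'.
Proof.
move=> eu eu'; have eA : e `<=` arrows G by move=> x ex; apply: units_arrow (eu x ex).
rewrite set_gmul_unitr//.
by apply/seteqP; split=> x [ex]; rewrite /= units_src//; apply: eu.
Qed.

(** The image is idempotent modulo null sets. If g = h k with all three in one bisection, equal
    sources give k = g and equal ranges give h = g; an arrow with g g = g is a unit. *)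
Lemma emb_unit e : measurable e -> e `<=` units G -> subn (f e) U.
Proof.
move=> me eu; have Bf := fB (Be me eu).
have := (emb_mul fE (Be me eu) (Be me eu)).1.
rewrite unit_gmul// setIid !subnE; apply: (null_sub Klam) => g [eg ng].
split=> // gg; move: gg => /set_gmulP[h [k [[eh ek Ah Ak] [hk e1]]]].
have kg : k = g by apply: (bisection_src Bf) => //; rewrite -e1 src_gmul.
have hg : h = g by apply: (bisection_rng Bf) => //; rewrite -e1 rng_gmul.
rewrite hg kg in hk e1; rewrite kg in Ak.
apply: ng; have <- : s g = g by rewrite -{2}(gmulKV Ak Ak hk) e1.
exact: src_units.
Qed.

Let nonunit_null e : measurable e -> e `<=` units G -> null (f e `\` U).
Proof. exact: emb_unit. Qed.

Lemma emb_mulr a e : B a -> measurable e -> e `<=` units G ->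
  eqn (f (set_gmul G a e)) (f a `&` s @^-1` (f e)).
Proof.
move=> Ba me eu; apply: (eqn_trans Klam (emb_mul fE Ba (Be me eu))).
split; last first.
  apply: (subset_subn Klam) => g [ag /= esg]; have Ag := fA Ba ag.
  apply/set_gmulP; exists g, (s g); do !split=> //; first exact: src_arrow.
    by rewrite rng_src.
  exact: gmul_src.
apply: (mean_null_sub Klam) (nonunit_null me eu).
move=> _ [_ [/set_gmulP[g [h [[ag eh Ag Ah] [gh <-]]]] n] <-].
rewrite src_gmul//; exists h => //; split=> // uh; apply: n.
by rewrite gmul_unitr//; split=> //=; rewrite gh units_rng.
Qed.

Lemma emb_mull a e : B a -> measurable e -> e `<=` units G ->
  eqn (f (set_gmul G e a)) (f a `&` r @^-1` (f e)).
Proof.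
move=> Ba me eu; apply: (eqn_trans Klam (emb_mul fE (Be me eu) Ba)).
split; last first.
  apply: (subset_subn Klam) => g [ag /= esg]; have Ag := fA Ba ag.
  apply/set_gmulP; exists (r g), g; do !split=> //; first exact: rng_arrow.
    by rewrite src_rng.
  exact: gmul_rng.
have := null_preim_rng Klam (fB Ba) (nonunit_null me eu).
apply: (mean_null_sub Klam) => _ [_ [/set_gmulP[h [g [[eh ag Ah Ag] [hg <-]]]] n] <-].
rewrite src_gmul//; exists g => //; split=> //=; rewrite -hg.
exists h => //; split=> // uh; apply: n.
by rewrite gmul_unitl//; split=> //=; rewrite -hg units_src.
Qed.

(* The images of the empty set and of the unit are at distance 1, and the
   former is contained in the latter, which leaves it no room. *)
Lemma emb_set0 : null (f set0).
Proof.
have mG := units_measurable Gd.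
have m0 : measurable (set0 : set T) by [].
have s0 : set0 `<=` units G by [].
have P1 : subn (f set0) U := emb_unit m0 s0.
have E1 : subn (f (units G)) U := emb_unit mG (@subset_refl _ _).
have PE : subn (f set0) (f (units G)).
  have := (emb_mulr (fsB_set0 G) mG (@subset_refl _ _)).1.
  rewrite set_gmul_unitr// (_ : [set g | _] = set0); last first.
    by apply/seteqP; split=> x // [].
  move=> h; apply: (mean_null_sub Klam) (mean_nullU Klam P1 h) => //.
  rewrite -image_setU; apply: image_subset => g [Pg nE].
  have [ug|nu] := pselect (U g); last by left.
  by right; split=> // -[_]; rewrite /= units_src.
have d1 := emb_dist fE (Be mG (@subset_refl _ _)) (fsB_set0 G).
rewrite setY0 (@src_image_units _ G)// in d1.
have mu1 : mu (units G) = 1%E by case: Gpmp.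
rewrite mu1 /= in d1.
have : lam (s @` (f (units G) `+` f set0)) <= lam ((f (units G) `\` f set0) `&` U).
  rewrite setY_def image_setU.
  apply: le_trans (mean_subadd Klam _ _) _; rewrite PE addr0.
  have : subn (f (units G) `\` f set0) ((f (units G) `\` f set0) `&` U).
    by apply: (null_sub Klam) E1 => g [[Eg nP] n]; split=> // ug; apply: n.
  move=> /(subn_mean Klam)/le_trans; apply.
  by rewrite (src_image_units (@subIsetr _ _ _)).
rewrite d1 => le1.
have lamP : lam (f set0 `&` U) = 0.
  apply/eqP; rewrite eq_le (mean_ge0 Klam) andbT.
  have := mean_le1 Klam (((f (units G) `\` f set0) `&` U) `|` (f set0 `&` U)).
  rewrite (meanU Klam); first lra.
  by rewrite -subset0 => g [[[_ nP] _] [P _]].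
have : subn (f set0) (f set0 `&` U).
  by apply: (null_sub Klam) P1 => g [Pg n]; split=> // ug; apply: n.
move=> /(subn_null Klam); apply.
by rewrite nullE (src_image_units (@subIsetr _ _ _)).
Qed.

Lemma emb_mean a : B a -> lam (s @` f a) = pr (src G @` a).
Proof.
move=> Ba; have := emb_dist fE Ba (fsB_set0 G); rewrite setY0 => <-.
apply: (eqn_mean Klam); split.
  apply: (null_sub Klam) emb_set0 => x [ax n]; apply: contrapT => nx.
  by apply: n; left.
apply: (null_sub Klam) emb_set0 => x [[[//]|[+ _] _]]; exact.
Qed.

Lemma emb_eqn a b : B a -> B b -> mu (src G @` (a `+` b)) = 0%E -> eqn (f a) (f b).
Proof.
move=> Ba Bb ab; have := emb_dist fE Ba Bb; rewrite ab => h.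
by split; apply: (mean_null_sub Klam) h => //; apply: image_subset => x ?; [left|right].
Qed.

Let src_sub a : B a -> src G @` a `<=` units G.
Proof. by move=> Ba; apply: src_image_sub; apply: fsB_arrows. Qed.
Let rng_sub a : B a -> rng G @` a `<=` units G.
Proof. by move=> Ba; apply: rng_image_sub; apply: fsB_arrows. Qed.

(** The product of a with s(a) is a, which gives one inclusion; both sides have the measure of s(a),
    so [subn_rev] gives the other. *)
Lemma emb_src a : B a -> eqn (f (src G @` a)) (s @` f a).
Proof.
move=> Ba; have me := fsB_src_measurable Gd Ba; have eu := src_sub Ba.
have ae : set_gmul G a (src G @` a) = a.
  rewrite set_gmul_unitr//; last exact: fsB_arrows Ba.
  by apply/seteqP; split=> [g []//|g ag]; split=> //; exists g.
have sub : subn (s @` f a) (f (src G @` a)).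
  have := (emb_mulr Ba me eu).1; rewrite ae !subnE !nullE; apply: (mean_null_sub Klam) => //.
  move=> _ [_ [[g ag <-] n] <-]; rewrite src_src; last exact: fA ag.
  by exists g => //; split=> // -[_].
split=> //; apply: (subn_rev Klam) => //; first exact: fB (fsB_src Gd Ba).
have fu : s @` f a `<=` U by apply: src_image_sub; apply: fA.
by rewrite (emb_mean (fsB_src Gd Ba)) (src_image_units eu) (src_image_units fu) emb_mean.
Qed.

Lemma emb_rng a : B a -> eqn (f (rng G @` a)) (r @` f a).
Proof.
move=> Ba; have me := fsB_rng_measurable Gd Ba; have eu := rng_sub Ba.
have ae : set_gmul G (rng G @` a) a = a.
  rewrite set_gmul_unitl//; last exact: fsB_arrows Ba.
  by apply/seteqP; split=> [g []//|g ag]; split=> //; exists g.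
have sub : subn (r @` f a) (f (rng G @` a)).
  have := (emb_mull Ba me eu).1; rewrite ae !subnE !nullE.
  rewrite (mean_inv Klam); last exact: bisection_sub (@subDsetl _ _ _) (fB Ba).
  apply: (mean_null_sub Klam) => //.
  move=> _ [_ [[g ag <-] n] <-]; rewrite src_rng; last exact: fA ag.
  by exists g => //; split=> // -[_].
split=> //; apply: (subn_rev Klam) => //; first exact: fB (fsB_rng Gd Ba).
have fu : r @` f a `<=` U by apply: rng_image_sub; apply: fA.
rewrite (emb_mean (fsB_rng Gd Ba)) (src_image_units eu) (src_image_units fu).
by rewrite -(mean_inv Klam (fB Ba)) emb_mean// (mu_src_rng Gpmp Ba).
Qed.

Lemma emb_unitI e e' : measurable e -> e `<=` units G ->
  measurable e' -> e' `<=` units G -> eqn (f (e `&` e')) (f e `&` f e').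
Proof.
move=> me eu me' eu'; have := emb_mulr (Be me eu) me' eu'.
rewrite unit_gmul// => h; apply: (eqn_trans Klam h).
split; apply: (null_sub Klam) (nonunit_null me eu) => g [[eg eg'] n]; split=> // ug; apply: n.
  by split=> //; rewrite /= units_src in eg'.
by split=> //; rewrite /= units_src.
Qed.

(** Inclusion is algebraic: a is the product of b with the idempotent s(a). *)
Lemma emb_sub a b : B a -> B b -> a `<=` b -> subn (f a) (f b).
Proof.
move=> Ba Bb ab; have := (emb_mulr Bb (fsB_src_measurable Gd Ba) (src_sub Ba)).1.
rewrite set_gmul_unitr; [|exact: fsB_arrows Bb|exact: src_sub].
have -> : [set g | b g /\ (src G @` a) (src G g)] = a.
  apply/seteqP; split=> [g [bg [h ah hg]]|g ag]; last by split; [exact: ab|exists g].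
  suff <- : h = g by [].
  by apply: (bisection_src (fsB_bisection Bb)) => //; apply: ab.
by apply: (null_sub Klam) => x [ax n]; split=> // -[].
Qed.

Lemma emb_src_capI a b : B a -> B b ->
  lam (s @` f a `&` s @` f b) = pr (src G @` a `&` src G @` b).
Proof.
move=> Ba Bb; have [ma mb] := (fsB_src_measurable Gd Ba, fsB_src_measurable Gd Bb).
have e1 := eqnI Klam (emb_src Ba) (emb_src Bb).
have e2 := emb_unitI ma (src_sub Ba) mb (src_sub Bb).
have := eqn_mean Klam (eqn_trans Klam e2 e1).
rewrite emb_mean; last first.
  by apply: (Be (measurableI _ _ ma mb)); apply: subset_trans (@subIsetl _ _ _) (@src_sub _ Ba).
have fu : s @` f a `&` s @` f b `<=` U.
  by apply: subset_trans (@subIsetl _ _ _) _; apply: src_image_sub; apply: fA.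
have eu : src G @` a `&` src G @` b `<=` units G.
  exact: subset_trans (@subIsetl _ _ _) (@src_sub _ Ba).
by rewrite (src_image_units eu) (src_image_units fu) => ->.
Qed.

Lemma emb_rng_capI a b : B a -> B b ->
  lam (r @` f a `&` r @` f b) = pr (rng G @` a `&` rng G @` b).
Proof.
move=> Ba Bb; have [ma mb] := (fsB_rng_measurable Gd Ba, fsB_rng_measurable Gd Bb).
have e1 := eqnI Klam (emb_rng Ba) (emb_rng Bb).
have e2 := emb_unitI ma (rng_sub Ba) mb (rng_sub Bb).
have := eqn_mean Klam (eqn_trans Klam e2 e1).
rewrite emb_mean; last first.
  by apply: (Be (measurableI _ _ ma mb)); apply: subset_trans (@subIsetl _ _ _) (@rng_sub _ Ba).
have fu : r @` f a `&` r @` f b `<=` U.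
  by apply: subset_trans (@subIsetl _ _ _) _; apply: rng_image_sub; apply: fA.
have eu : rng G @` a `&` rng G @` b `<=` units G.
  exact: subset_trans (@subIsetl _ _ _) (@rng_sub _ Ba).
by rewrite (src_image_units eu) (src_image_units fu) => ->.
Qed.

(* The measure of s(a n b) is determined by d(a, b) and the measures of s(a),
   s(b) and s(a) n s(b). *)
Lemma emb_setI a b : B a -> B b -> eqn (f (a `&` b)) (f a `&` f b).
Proof.
move=> Ba Bb; have Bab := fsB_setI Ba Bb.
have sub : subn (f (a `&` b)) (f a `&` f b).
  have h1 := emb_sub Bab Ba (@subIsetl _ _ _).
  have h2 := emb_sub Bab Bb (@subIsetr _ _ _).
  by have := subnI Klam h1 h2; rewrite setIid.
split=> //; have bI : bisection K (f a `&` f b).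
  exact: bisection_sub (@subIsetl _ _ _) (fB Ba).
apply: (subn_rev Klam) => //; rewrite emb_mean//.
have sII (Y : Type) (L : groupoid Y) (p q : set Y) :
    src L @` (p `&` q) `<=` src L @` p `|` src L @` q.
  by move=> _ [x [px _] <-]; left; exists x.
have := emb_dist fE Ba Bb; rewrite (bisection_srcY (fB Ba) (fB Bb)).
rewrite (bisection_srcY (fsB_bisection Ba) (fsB_bisection Bb)).
have := mean_split Klam (s @` f a `|` s @` f b) (s @` (f a `&` f b)).
rewrite setIC (setIidl (sII _ _ _ _)).
have [ma mb] := (fsB_src_measurable Gd Ba, fsB_src_measurable Gd Bb).
have mab := fsB_src_measurable Gd Bab.
have := prob_split mu (measurableU _ _ ma mb) mab.
rewrite setIC (setIidl (sII _ _ _ _)).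
have := mean_modular Klam (s @` f a) (s @` f b).
have := prob_modular mu ma mb.
rewrite (emb_src_capI Ba Bb) !emb_mean//; lra.
Qed.

Lemma emb_setD a b : B a -> B b -> eqn (f (a `\` b)) (f a `\` f b).
Proof.
move=> Ba Bb; have Bab := fsB_setD Ba Bb; have Ia := fsB_setI Ba Bb.
have sub : subn (f (a `\` b)) (f a `\` f b).
  have h1 := emb_sub Bab Ba (@subDsetl _ _ _).
  have h2 : null (f (a `\` b) `&` f b).
    apply: (subn_null Klam) emb_set0; have := (emb_setI Bab Bb).2.
    by rewrite setDE -setIA setICl setI0.
  apply: (null_sub Klam) (nullU Klam h1 h2) => x [abx n].
  have [ax|na] := pselect (f a x); last by left.
  by right; split=> //; apply: contrapT => nb; apply: n.
split=> //; apply: (subn_rev Klam) => //.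
  exact: bisection_sub (@subDsetl _ _ _) (fB Ba).
rewrite emb_mean//.
have -> : f a `\` f b = f a `\` (f a `&` f b) by apply/seteqP; split=> x /=; tauto.
have -> : a `\` b = a `\` (a `&` b) by apply/seteqP; split=> x /=; tauto.
rewrite (bisection_srcD (fB Ba) (@subIsetl _ _ _)).
rewrite (bisection_srcD (fsB_bisection Ba) (@subIsetl _ _ _)).
have := mean_split Klam (s @` f a) (s @` (f a `&` f b)).
have := prob_split mu (fsB_src_measurable Gd Ba) (fsB_src_measurable Gd Ia).
have sI (Y : Type) (L : groupoid Y) (p q : set Y) :
    src L @` p `&` src L @` (p `&` q) = src L @` (p `&` q).
  by apply: setIidr; apply: image_subset; apply: subIsetl.
rewrite !sI.
rewrite -(eqn_mean Klam (emb_setI Ba Bb)) !emb_mean//; lra.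
Qed.

(** The pieces are removed from [a] one at a time by [emb_setD]. What remains of [a] is empty, and
    its image, which contains almost everything outside the union of the images, is null. *)
Lemma emb_bigcup (I : finType) (F : I -> set T) a : B a -> (forall i, B (F i)) ->
  a = \bigcup_i F i -> eqn (f a) (\bigcup_i f (F i)).
Proof.
move=> Ba BF aF; split; last first.
  have h i : subn (f (F i)) (f a) by apply: emb_sub => //; rewrite aF => x Fx; exists i.
  apply: (null_sub Klam) (null_bigcup Klam h) => x [[i _ Fx] n]; by exists i.
have h (t : seq I) : exists b, [/\ B b, b `<=` a, forall x i, i \in t -> F i x -> ~ b x &
    subn (f a `\` \bigcup_i f (F i)) (f b)].
  elim: t => [|j t [b [Bb ba bt sub]]].
    by exists a; split=> //; apply: (subset_subn Klam); apply: subDsetl.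
  exists (b `\` F j); split.
  - exact: fsB_setD.
  - by move=> x [/ba].
  - move=> x i; rewrite inE => /orP[/eqP->|it] Fx [bx nF]; first exact: nF.
    exact: (bt x i it Fx bx).
  - apply: (subn_trans Klam) (emb_setD Bb (BF j)).2.
    apply: (null_sub Klam) sub => x [[ax nF] n]; split; first by split.
    by move=> bx; apply: n; split=> // Fx; apply: nF; exists j.
have [b [Bb ba bt sub]] := h (enum I).
apply: (subn_null Klam sub); have -> : b = set0; last exact: emb_set0.
rewrite -subset0 => x bx; have := ba _ bx; rewrite aF => -[i _ Fx].
by apply: (bt x i _ Fx bx); rewrite mem_enum.
Qed.

Lemma emb_setU a b : B a -> B b -> B (a `|` b) -> eqn (f (a `|` b)) (f a `|` f b).
Proof.
move=> Ba Bb Bab; have := @emb_bigcup bool (fun i => if i then a else b) _ Bab.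
have bU (Y : Type) (p q : bool -> set Y) :
    \bigcup_(i : bool) (if i then p i else q i) = p true `|` q false.
  apply/seteqP; split=> [x [[] _ ?]|x [?|?]]; [by left|by right| |].
    by exists true.
  by exists false.
have -> : \bigcup_i (if i then a else b) = a `|` b by rewrite (bU _ (fun=> a) (fun=> b)).
have -> : \bigcup_i f (if i then a else b) = f a `|` f b.
  rewrite -(bU _ (fun=> f a) (fun=> f b)); congr bigcup.
  by apply/funext => -[].
by apply=> // -[].
Qed.

Lemma emb_srcY a b : B a -> B b ->
  eqn (f (src G @` (a `+` b))) (s @` (f a `+` f b)).
Proof.
move=> Ba Bb; rewrite !setY_def !image_setU.
have [B1 B2] := (fsB_setD Ba Bb, fsB_setD Bb Ba).
have BU : B (src G @` (a `\` b) `|` src G @` (b `\` a)).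
  apply: Be; last by move=> x [|]; apply: src_sub.
  by apply: measurableU; apply: (fsB_src_measurable Gd).
apply: (eqn_trans Klam (emb_setU (fsB_src Gd B1) (fsB_src Gd B2) BU)).
have h c e : B c -> B e -> B (c `\` e) ->
    eqn (f (src G @` (c `\` e))) (s @` (f c `\` f e)).
  move=> Bc Bf Bce; apply: (eqn_trans Klam (emb_src Bce)).
  apply: (eqn_src Klam) (emb_setD Bc Bf); first exact: fA.
  by apply: subset_trans (@subDsetl _ _ _) (fA Bc).
by apply: (eqnU Klam); apply: h.
Qed.

End MeanEmbedding.

(** * The amplified embedding *)

Section Amplification.
Context {X : Type} (n : nat) (K : groupoid X).

(* The product of K with the full equivalence relation on 'I_n. *)
Definition amp_mul (x y : X * ('I_n * 'I_n)) : X * ('I_n * 'I_n) :=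
  (gmul K x.1 y.1, (x.2.1, y.2.2)).

Definition amp_inv (x : X * ('I_n * 'I_n)) : X * ('I_n * 'I_n) :=
  (ginv K x.1, (x.2.2, x.2.1)).

Lemma amp_axioms : groupoid_axioms [set x | arrows K x.1] amp_mul amp_inv.
Proof.
have E g h : amp_mul (amp_inv g) g = amp_mul h (amp_inv h) ->
    src K g.1 = rng K h.1 /\ g.2.2 = h.2.1 by case.
split=> /=.
- by move=> g; apply: ginv_arrow.
- by move=> [g [i j]] Ag; congr pair; apply: ginvK.
- by move=> g h Ag Ah /E[gh _]; apply: gmul_arrow.
- move=> g h Ag Ah /E[gh _]; rewrite /amp_mul /=.
  by rewrite -/(src K (gmul K g.1 h.1)) src_gmul.
- move=> g h Ag Ah /E[gh _]; rewrite /amp_mul /=.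
  by rewrite -/(rng K (gmul K g.1 h.1)) rng_gmul.
- by move=> g h k Ag Ah Ak /E[gh _] /E[hk _]; rewrite /amp_mul /= gmulA.
- by move=> [g [i j]] Ag; congr pair; apply: gmul_src.
- by move=> [g [i j]] Ag; congr pair; apply: gmul_rng.
Qed.

Definition amp : groupoid (X * ('I_n * 'I_n)) := Groupoid amp_axioms.

Definition blk (Y : set (X * ('I_n * 'I_n))) i j : set X := [set g | Y (g, (i, j))].

(** Units of the amplification sit on the diagonal, in n copies of the units of [K]; hence diagonal
    blocks only and the factor 1/n. *)
Definition amp_mean (R : realType) (lam : set X -> R)
    (E : set (X * ('I_n * 'I_n))) : R := n%:R^-1 * \sum_(j < n) lam (blk E j j).

Lemma blk_src Y j : blk (src amp @` Y) j j = \bigcup_i src K @` blk Y i j.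
Proof.
apply/seteqP; split=> [x [[g [i k]] Yg [<- <-]]|_ [i _ [g Yg <-]]].
  by exists i => //; exists g.
by exists (g, (i, j)).
Qed.

Lemma blk_setY Y Z i j : blk (Y `+` Z) i j = blk Y i j `+` blk Z i j.
Proof. by []. Qed.

Lemma blk_gmul Y Z i l : blk (set_gmul amp Y Z) i l =
  \bigcup_j set_gmul K (blk Y i j) (blk Z j l).
Proof.
apply/seteqP; split=> [x|x [j _]].
  move=> /set_gmulP[[g [i' j]] [[h [k l']] [[/= Yg Zh Ag Ah] [e [<- ii ll]]]]].
  case: e => gh jk _; exists j => //; apply/set_gmulP; exists g, h.
  by rewrite /blk /= -ii -ll; do !split=> //; rewrite jk.
move=> /set_gmulP[g [h [[Yg Zh Ag Ah] [gh <-]]]]; apply/set_gmulP.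
by exists (g, (i, j)), (h, (j, l)); do !split=> //; congr pair.
Qed.

Lemma amp_mean_const (R : realType) (lam : set X -> R) (c : R)
    (E : set (X * ('I_n * 'I_n))) : (0 < n)%N ->
  (forall j, lam (blk E j j) = c) -> amp_mean lam E = c.
Proof.
move=> n_gt0 Ec; rewrite /amp_mean (eq_bigr (fun=> c)) => [|j _]; last exact: Ec.
rewrite sumr_const card_ord -[c *+ n]mulr_natl mulKf//.
by rewrite pnatr_eq0 -lt0n.
Qed.

End Amplification.

(** * The block embedding *)

Section AmplifiedEmbedding.
Context {R : realType} {d : measure_display} {T : measurableType d}.
Variables (G : groupoid T) (mu : probability T R) (Gpmp : pmp_groupoid G mu).
Variables (H : set T) (HG : is_subgroupoid G H).
Variables (n : nat) (psi : 'I_n -> set T).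
Hypothesis psifull : forall i, full_group G mu (psi i).
Hypothesis psicover : mu.-negligible
  (src G @` (arrows G `\` \bigcup_i set_gmul G (psi i) H)).
Hypothesis psidisj : forall i j, i != j -> mu.-negligible
  (src G @` (set_gmul G (psi i) H `&` set_gmul G (psi j) H)).
Context {X : Type} (K : groupoid X) (lam : set X -> R).
Hypothesis Klam : mean_groupoid K lam.
Variable f : set T -> set X.
Hypothesis fE : mean_embedding (subgroupoid HG) mu K lam f.
Local Notation L := (subgroupoid HG).
Local Notation B := (full_semigroup_B G).
Local Notation BH := (full_semigroup_B L).
Local Notation cmp i a j := (cmp G H psi i a j).
Local Notation eqn := (eqn K lam).
Local Notation null := (null K lam).
Local Notation s := (src K).
Local Notation r := (rng K).
Local Notation "''A'" := (amp n K).
Local Notation pr E := (fine (mu E)).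

Let Lpmp : pmp_groupoid L mu := sub_pmp Gpmp HG psifull psicover.
Let Ld := pmp_discrete Lpmp.
Let Gd := pmp_discrete Gpmp.
Let cB a i j : B a -> BH (cmp i a j).
Proof. by move=> Ba; apply: (cmp_B Gpmp HG psifull Ba). Qed.
Let fB a : BH a -> bisection K (f a). Proof. exact: embB fE _. Qed.
Let fA a : BH a -> f a `<=` arrows K. Proof. by move=> /fB[]. Qed.

Definition amp_raw (a : set T) : set (X * ('I_n * 'I_n)) :=
  [set x | f (cmp x.2.1 a x.2.2) x.1].

(* The blocks f(a_ij) have almost disjoint sources and ranges; deleting the
   overlaps turns the block matrix into a bisection. *)
Definition amp_emb (a : set T) : set (X * ('I_n * 'I_n)) :=
  [set x | amp_raw a x /\ forall y, amp_raw a y ->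
     src 'A y = src 'A x \/ rng 'A y = rng 'A x -> y = x].

Lemma amp_emb_bisection a : B a -> bisection 'A (amp_emb a).
Proof.
move=> Ba; apply: bisectionP.
- by move=> x [fx _]; apply: fA fx; apply: cB.
- by move=> x y [_ xP] [fy _] e; apply/esym; apply: xP => //; left.
- by move=> x y [_ xP] [fy _] e; apply/esym; apply: xP => //; right.
Qed.

(** Within one block [f] already gives a bisection, so an arrow is deleted only if it shares its
    source with another block of column j or its range with another block of row i. These finitely
    many overlaps are null, since the corresponding blocks in [H] have almost disjoint sources or
    ranges. *)
Lemma blk_amp_emb a i j : B a -> eqn (blk (amp_emb a) i j) (f (cmp i a j)).
Proof.
move=> Ba; split; first by apply: (subset_subn Klam) => g [].
pose Es i' := f (cmp i a j) `&`
  [set g | i' != i /\ (s @` f (cmp i' a j)) (s g)].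
pose Er j' := f (cmp i a j) `&`
  [set g | j' != j /\ (r @` f (cmp i a j')) (r g)].
have Es0 i' : null (Es i').
  have [->|ii] := eqVneq i' i.
    by apply: (null_sub Klam) (null_set0 Klam) => g [_ []]; rewrite eqxx.
  have d0 := cmp_src_disj Gpmp HG psifull psidisj Ba j ii.
  have := emb_src_capI Klam Lpmp fE (cB i' j Ba) (cB i j Ba).
  rewrite [mu _]d0 => l0; rewrite nullE; apply: (mean_null_sub Klam) l0.
  by move=> _ [g [fg [_ sg]] <-]; split=> //; exists g.
have Er0 j' : null (Er j').
  have [->|jj] := eqVneq j' j.
    by apply: (null_sub Klam) (null_set0 Klam) => g [_ []]; rewrite eqxx.
  have d0 := cmp_rng_disj Gpmp HG psifull psidisj Ba i jj.
  have := emb_rng_capI Klam Lpmp fE (cB i j' Ba) (cB i j Ba).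
  rewrite [mu _]d0 => /(null_preim_rng Klam (fB (cB i j Ba))) l0.
  apply: (null_sub Klam) l0.
  by move=> g [fg [_ rg]]; split=> //; split=> //; exists g.
apply: (null_sub Klam) (nullU Klam (null_bigcup Klam Es0) (null_bigcup Klam Er0)).
move=> g [fg n0]; apply: contrapT => n1; apply: n0; split=> //.
move=> [h [i' j']] /= fh [] [e1 e2 _].
  have jj : j' = j by [].
  subst j'; have [ii|ii] := eqVneq i' i.
    by rewrite ii in fh *; congr pair; apply: (bisection_src (fB (cB i j Ba))).
  case: n1; left; exists i' => //; split=> //; split=> //.
  by exists h.
have ii : i' = i by [].
subst i'; have [jj|jj] := eqVneq j' j.
  by rewrite jj in fh *; congr pair; apply: (bisection_rng (fB (cB i j Ba))).
case: n1; right; exists j' => //; split=> //; split=> //.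
by exists h.
Qed.

Let n_gt0 : (0 < n)%N := finite_index_gt0 Gpmp psicover.

(** Modulo null sets, column j of the sources is the image under [f] of the union [W] from
    [cmp_dist], whose measure does not depend on j. *)
Lemma amp_emb_dist a b : B a -> B b ->
  amp_mean lam (src 'A @` (amp_emb a `+` amp_emb b)) = pr (src G @` (a `+` b)).
Proof.
move=> Ba Bb; apply: (amp_mean_const n_gt0) => j; rewrite blk_src.
rewrite -(cmp_dist Gpmp HG psifull psicover j Ba Bb).
set W := \bigcup_i src G @` _.
have mW i : BH (src G @` (cmp i a j `+` cmp i b j)).
  have [c1 c2] := (cB i j Ba, cB i j Bb).
  apply: (@fsB_unit _ _ L).
    rewrite setY_def image_setU; apply: measurableU.
      by apply: (fsB_src_measurable Ld); apply: fsB_setD.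
    by apply: (fsB_src_measurable Ld); apply: fsB_setD.
  apply: (@src_image_sub _ L) => h [[ch _]|[ch _]].
    exact: fsB_arrows c1 _ ch.
  exact: fsB_arrows c2 _ ch.
have Wu : W `<=` units L.
  move=> _ [i _ [h [[ch _]|[ch _]] <-]]; apply: (@src_units _ L).
    exact: fsB_arrows (cB i j Ba) _ ch.
  exact: fsB_arrows (cB i j Bb) _ ch.
have BW : BH W.
  apply: fsB_unit Wu; apply: fin_bigcup_measurable => // i _.
  exact: fsB_measurable (mW i).
have -> : pr W = lam (s @` f W).
  by rewrite (emb_mean Klam Lpmp fE BW) (@src_image_units _ L).
have eW := emb_bigcup Klam Lpmp fE BW mW erefl.
have eY i : eqn (f (src G @` (cmp i a j `+` cmp i b j)))
    (s @` blk (amp_emb a `+` amp_emb b) i j).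
  have [c1 c2] := (cB i j Ba, cB i j Bb).
  apply: (eqn_trans Klam (emb_srcY Klam Lpmp fE c1 c2)).
  rewrite blk_setY !setY_def; apply: (eqn_src Klam).
  - by move=> g [[+ _]|[+ _]]; apply: fA.
  - by move=> g [[[+ _] _]|[[+ _] _]]; apply: fA; apply: cB.
  - have [e1 e2] := (eqn_sym (blk_amp_emb i j Ba), eqn_sym (blk_amp_emb i j Bb)).
    by apply: (eqnU Klam); apply: (eqnD Klam).
rewrite (eqn_mean Klam (eqn_trans Klam eW (eqn_bigcup Klam eY))).
congr lam; apply/esym; apply: src_image_units => _ [i _ [g bg <-]].
apply: src_units; case: bg => -[[fg _] _].
  exact: (fA (cB i j Ba) fg).
exact: (fA (cB i j Bb) fg).
Qed.

Lemma amp_emb_mul a b : B a -> B b ->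
  amp_mean lam (src 'A @` (amp_emb (set_gmul G a b) `+`
                           set_gmul 'A (amp_emb a) (amp_emb b))) = 0.
Proof.
move=> Ba Bb; have Bab := fsB_mul Gd Ba Bb; apply: (amp_mean_const n_gt0) => l.
rewrite blk_src; suff e i : eqn (blk (amp_emb (set_gmul G a b)) i l)
    (blk (set_gmul 'A (amp_emb a) (amp_emb b)) i l).
  rewrite -image_bigcup; apply: (null_bigcup Klam) => i; rewrite blk_setY setY_def.
  by case: (e i) => e1 e2; apply: (nullU Klam).
rewrite blk_gmul; apply: (eqn_trans Klam (blk_amp_emb i l Bab)).
have Bc j : BH (set_gmul L (cmp i a j) (cmp j b l)) by apply: (fsB_mul Ld); apply: cB.
have sub : \bigcup_j set_gmul L (cmp i a j) (cmp j b l) `<=` cmp i (set_gmul G a b) l.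
  by move=> h [j _]; apply: (cmp_gmul_sub psifull).
have BU : BH (\bigcup_j set_gmul L (cmp i a j) (cmp j b l)).
  apply: (fsB_sub _ sub (cB i l Bab)); apply: fin_bigcup_measurable => // j _.
  exact: fsB_measurable (Bc j).
have e1 : eqn (f (cmp i (set_gmul G a b) l))
    (f (\bigcup_j set_gmul L (cmp i a j) (cmp j b l))).
  apply: (emb_eqn Klam fE (cB i l Bab) BU).
  rewrite setY_def; move: (sub); rewrite -setD_eq0 => ->; rewrite setU0.
  exact: (cmp_gmul_cover Gpmp HG psifull psicover).
apply: (eqn_trans Klam e1); apply: (eqn_trans Klam (emb_bigcup Klam Lpmp fE BU Bc erefl)).
apply: (eqn_bigcup Klam) => j.
apply: (eqn_trans Klam (emb_mul fE (cB i j Ba) (cB j l Bb))).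
have [e2 e3] := (eqn_sym (blk_amp_emb i j Ba), eqn_sym (blk_amp_emb j l Bb)).
apply: (eqn_mul Klam) e2 e3; first exact: fB (cB j l Bb).
by apply: bisection_sub (fB (cB j l Bb)) => g [].
Qed.

End AmplifiedEmbedding.

(** * Ultraproducts of finite groupoids *)

Section MeanBigcup.
Context {R : realType} {X : Type} (K : groupoid X) (lam : set X -> R).
Hypothesis Klam : mean_groupoid K lam.

Lemma mean_bigcup (I : finType) (F : I -> set X) :
  (forall i j x, F i x -> F j x -> i = j) ->
  lam (\bigcup_i F i) = \sum_i lam (F i).
Proof.
move=> dis; suff h (t : seq I) : uniq t ->
    lam [set x | exists2 i, i \in t & F i x] = \sum_(i <- t) lam (F i).
  rewrite -h ?index_enum_uniq//; congr lam; apply/seteqP; split=> x.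
    by move=> [i _ Fx]; exists i; rewrite ?mem_index_enum.
  by move=> [i _ Fx]; exists i.
elim: t => [_|j t ih /= /andP[jt ut]].
  by rewrite big_nil -(mean0 Klam); congr lam; rewrite -subset0 => x [].
rewrite big_cons -ih// -(meanU Klam).
  congr lam; apply/seteqP; split=> [x [i]|x [Fx|[i it Fx]]].
  - by rewrite inE => /orP[/eqP->|it] Fx; [left|right; exists i].
  - by exists j; rewrite ?mem_head.
  - by exists i; rewrite // inE it orbT.
rewrite -subset0 => x [Fx [i it Fx']].
by move: jt; rewrite (dis _ _ _ Fx Fx') it.
Qed.

End MeanBigcup.

Section AmpMean.
Context {R : realType} {X : Type} (K : groupoid X) (lam : set X -> R).
Hypothesis Klam : mean_groupoid K lam.
Variable n : nat.
Hypothesis n_gt0 : (0 < n)%N.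

Lemma amp_src x : src (amp n K) x = (src K x.1, (x.2.2, x.2.2)).
Proof. by []. Qed.

Lemma amp_rng x : rng (amp n K) x = (rng K x.1, (x.2.1, x.2.1)).
Proof. by []. Qed.

Lemma blk_rng (Y : set (X * ('I_n * 'I_n))) i :
  blk (rng (amp n K) @` Y) i i = \bigcup_j rng K @` blk Y i j.
Proof.
apply/seteqP; split=> [x [[g [k j]] Yg [<- <-]]|_ [j _ [g Yg <-]]].
  by exists j => //; exists g.
by exists (g, (i, j)).
Qed.

Lemma blk_bisection (a : set (X * ('I_n * 'I_n))) i j : bisection (amp n K) a ->
  bisection K (blk a i j).
Proof.
move=> ba; have [aA _ _] := ba; apply: bisectionP => [g /aA//|g h ag ah e|g h ag ah e].
  by have := bisection_src ba ag ah; rewrite !amp_src /= e => /(_ erefl)[].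
by have := bisection_rng ba ag ah; rewrite !amp_rng /= e => /(_ erefl)[].
Qed.

(** Invariance is an exchange of sums: blocks in one column have disjoint sources, blocks in one row
    have disjoint ranges, and each single block is a bisection of [K]. *)
Lemma amp_mean_groupoid : mean_groupoid (amp n K) (amp_mean lam).
Proof.
split.
- move=> E; rewrite mulr_ge0// ?invr_ge0 ?ler0n// sumr_ge0// => j _.
  exact: mean_ge0 Klam _.
- move=> E F EF; rewrite /amp_mean -mulrDr -big_split /=; congr (_ * _).
  apply: eq_bigr => j _; rewrite -(meanU Klam)// -subset0 => x [Ex Fx].
  by have : (E `&` F) (x, (j, j)) by []; rewrite EF.
- move=> E; rewrite ler_pdivrMl ?ltr0n// mulr1.
  apply: (@le_trans _ _ (\sum_(j < n) 1)).
    by apply: ler_sum => j _; apply: mean_le1 Klam _.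
  by rewrite sumr_const card_ord.
- move=> a ba; congr (_ * _).
  transitivity (\sum_(j < n) \sum_(i < n) lam (src K @` blk a i j)).
    apply: eq_bigr => j _; rewrite blk_src (mean_bigcup Klam)//.
    move=> i i' _ [g ag <-] [h ah hg].
    by have := bisection_src ba ag ah; rewrite !amp_src /= hg => /(_ erefl)[].
  rewrite exchange_big /=; apply: eq_bigr => i _.
  rewrite blk_rng (mean_bigcup Klam); last first.
    move=> j j' _ [g ag <-] [h ah hg].
    by have := bisection_rng ba ag ah; rewrite !amp_rng /= hg => /(_ erefl)[].
  by apply: eq_bigr => j _; rewrite (mean_inv Klam)//; apply: blk_bisection.
Qed.

End AmpMean.

(** * Limits along an ultrafilter *)

Section UltraLimit.
Context {R : realType} (U : set_system nat).
Hypothesis HU : UltraFilter U.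
Implicit Types v w : nat -> R.

Let UP : ProperFilter U. Proof. exact: ultra_proper. Qed.

(** Compactness of the unit interval gives a cluster point, and for an ultrafilter a cluster point
    is a limit. *)
Lemma ultra_cvg v : (forall k, 0 <= v k <= 1) -> cvg (v @ U).
Proof.
move=> v01; have F01 : (v @ U) `[0, 1]%classic.
  apply: (@filterS _ U _ setT) => [k _|]; last exact: filterT.
  by rewrite /preimage /= in_itv; exact: v01.
have [p [_ vp]] := @segment_compact R 0 1 (v @ U) _ F01.
apply/cvg_ex; exists p => B Bp.
have [//|nB] := in_ultra_setVsetC (v @^-1` B) HU.
by have [x []] := vp (~` B) B nB Bp.
Qed.

Definition ulim v : R := lim (v @ U).

Lemma ulimD v w : (forall k, 0 <= v k <= 1) -> (forall k, 0 <= w k <= 1) ->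
  ulim (fun k => v k + w k) = ulim v + ulim w.
Proof.
by move=> v1 w1; apply: cvg_lim => //; apply: cvgD; apply: ultra_cvg.
Qed.

Lemma ulim_ge0 v : (forall k, 0 <= v k <= 1) -> 0 <= ulim v.
Proof.
move=> v1; apply: limr_ge; first exact: ultra_cvg.
by apply: filterS (@filterT _ U _) => k _; case/andP: (v1 k).
Qed.

Lemma ulim_le1 v : (forall k, 0 <= v k <= 1) -> ulim v <= 1.
Proof.
move=> v1; apply: limr_le; first exact: ultra_cvg.
by apply: filterS (@filterT _ U _) => k _; case/andP: (v1 k).
Qed.

Lemma ulim_average n (v : 'I_n -> nat -> R) (c : R) :
  (forall j k, 0 <= v j k <= 1) ->
  ulim (fun k => c * \sum_j v j k) = c * \sum_j ulim (v j).
Proof.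
move=> v1; apply: cvg_lim => //; apply: cvgM; first exact: cvg_cst.
apply: (cvg_big (op := +%R)) => [|j _]; last exact: ultra_cvg.
by move=> x; apply: add_continuous.
Qed.

End UltraLimit.

(** * The disjoint union of a sequence of groupoids *)

Section SumGroupoid.
Context {T_ : nat -> Type} (G_ : forall k, groupoid (T_ k)).
Local Notation X := {k : nat & T_ k}.

(** For different tags [tagged_as] returns a default value; this is harmless, as composable arrows
    have equal tags. *)
Definition sum_mul (x y : X) : X :=
  Tagged T_ (gmul (G_ (tag x)) (tagged x) (tagged_as x y)).

Definition sum_inv (x : X) : X := Tagged T_ (ginv (G_ (tag x)) (tagged x)).

Lemma sum_mulE k (a b : T_ k) :
  sum_mul (Tagged T_ a) (Tagged T_ b) = Tagged T_ (gmul (G_ k) a b).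
Proof. by rewrite /sum_mul tagged_asE. Qed.

Let tag_inj k (a b : T_ k) : Tagged T_ a = Tagged T_ b -> a = b.
Proof.
by move=> /(congr1 (tagged_as (Tagged T_ a))); rewrite !(tagged_asE (u := Tagged T_ a)).
Qed.

Lemma sum_axioms : groupoid_axioms [set x : X | arrows (G_ (tag x)) (tagged x)]
  sum_mul sum_inv.
Proof.
have tagE (x y : X) : sum_mul (sum_inv x) x = sum_mul y (sum_inv y) ->
    exists k (a b : T_ k), [/\ x = Tagged T_ a, y = Tagged T_ b &
      src (G_ k) a = rng (G_ k) b].
  case: x y => [k a] [l b] e; have kl : k = l by have := congr1 tag e.
  subst l; exists k, a, b; split=> //; apply: tag_inj.
  by move: e; rewrite !sum_mulE.
split.
- by move=> [k a]; apply: (@ginv_arrow _ (G_ k) a).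
- by move=> [k a] /= Aa; rewrite /sum_inv; congr Tagged; apply: ginvK.
- move=> x y Ax Ay /tagE[k [a [b [ex ey ab]]]]; subst x y; rewrite sum_mulE.
  move: Ax Ay => /= Aa Ab; exact: (gmul_arrow Aa Ab ab).
- move=> x y Ax Ay /tagE[k [a [b [ex ey ab]]]]; subst x y; rewrite sum_mulE.
  by move: Ax Ay => /= Aa Ab; rewrite /sum_inv /= !sum_mulE -!/(src _ _) src_gmul.
- move=> x y Ax Ay /tagE[k [a [b [ex ey ab]]]]; subst x y; rewrite sum_mulE.
  by move: Ax Ay => /= Aa Ab; rewrite /sum_inv /= !sum_mulE -!/(rng _ _) rng_gmul.
- move=> x y [l c] Ax Ay Ac /tagE[k [a [b [ex ey ab]]]]; subst x y.
  move: Ax Ay Ac => /= Aa Ab Ac /tagE[k' [b' [c' [bb cc bc]]]].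
  have kk : k = k' by have := congr1 tag bb.
  subst k'; have lk : l = k by have := congr1 tag cc.
  subst l; move/tag_inj: bb => bb; move/tag_inj: cc => cc; subst b' c'.
  by rewrite (sum_mulE a b) (sum_mulE b c) !sum_mulE (gmulA Aa Ab Ac ab bc).
- move=> [k a] /= Aa; rewrite /sum_inv /= (sum_mulE (ginv (G_ k) a) a) sum_mulE.
  by rewrite -/(src _ _) gmul_src.
- move=> [k a] /= Aa; rewrite /sum_inv /= (sum_mulE a (ginv (G_ k) a)) sum_mulE.
  by rewrite -/(rng _ _) gmul_rng.
Qed.

Definition sum_groupoid : groupoid X := Groupoid sum_axioms.
Local Notation K := sum_groupoid.

Definition slice (Y : set X) k : set (T_ k) := [set a | Y (Tagged T_ a)].
Arguments slice Y k : clear implicits.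

Lemma src_sum k (a : T_ k) : src K (Tagged T_ a) = Tagged T_ (src (G_ k) a).
Proof. by rewrite /src /= /sum_inv /= sum_mulE. Qed.

Lemma rng_sum k (a : T_ k) : rng K (Tagged T_ a) = Tagged T_ (rng (G_ k) a).
Proof. by rewrite /rng /= /sum_inv /= sum_mulE. Qed.

Lemma slice_src Y k : slice (src K @` Y) k = src (G_ k) @` slice Y k.
Proof.
apply/seteqP; split=> [a [[l b] Yb]|_ [b Yb <-]].
  rewrite src_sum => e; have lk : l = k by have := congr1 tag e.
  by subst l; exists b => //; apply: tag_inj.
by exists (Tagged T_ b) => //; rewrite src_sum.
Qed.

Lemma slice_rng Y k : slice (rng K @` Y) k = rng (G_ k) @` slice Y k.
Proof.
apply/seteqP; split=> [a [[l b] Yb]|_ [b Yb <-]].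
  rewrite rng_sum => e; have lk : l = k by have := congr1 tag e.
  by subst l; exists b => //; apply: tag_inj.
by exists (Tagged T_ b) => //; rewrite rng_sum.
Qed.

Lemma slice_gmul Y Z k : slice (set_gmul K Y Z) k =
  set_gmul (G_ k) (slice Y k) (slice Z k).
Proof.
apply/seteqP; split=> [c|c] /set_gmulP.
  move=> [[l a] [[l' b] [[Ya Zb Aa Ab] []]]]; rewrite src_sum rng_sum => e.
  have ll : l = l' by have := congr1 tag e.
  subst l' => /=; rewrite sum_mulE => e'.
  have lk : l = k by have := congr1 tag e'.
  subst l; apply/set_gmulP; exists a, b; split; first by split.
  by split; [exact: tag_inj|exact: tag_inj e'].
move=> [a [b [[Ya Zb Aa Ab] [ab <-]]]]; apply/set_gmulP.
exists (Tagged T_ a), (Tagged T_ b); split; first by split.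
by split; [rewrite src_sum rng_sum ab|exact: sum_mulE].
Qed.

Lemma slice_bisection Y k : bisection K Y -> bisection (G_ k) (slice Y k).
Proof.
move=> bY; have [YA _ _] := bY.
apply: bisectionP => [a /YA//|a b Ya Yb e|a b Ya Yb e]; apply: tag_inj.
  by apply: (bisection_src bY) => //; rewrite !src_sum e.
by apply: (bisection_rng bY) => //; rewrite !rng_sum e.
Qed.

Lemma bisection_slices Y : (forall k, bisection (G_ k) (slice Y k)) -> bisection K Y.
Proof.
move=> bY; apply: bisectionP.
- by move=> [k a] Ya; have [+ _ _] := bY k; apply.
- move=> [k a] [l b] Ya Yb; rewrite !src_sum => e.
  have kl : k = l by have := congr1 tag e.
  by subst l; congr Tagged; apply: (bisection_src (bY k)) => //; apply: tag_inj.
- move=> [k a] [l b] Ya Yb; rewrite !rng_sum => e.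
  have kl : k = l by have := congr1 tag e.
  by subst l; congr Tagged; apply: (bisection_rng (bY k)) => //; apply: tag_inj.
Qed.

Context {R : realType} (U : set_system nat) (HU : UltraFilter U).
Variable m_ : forall k, set (T_ k) -> R.
Hypothesis Km : forall k, mean_groupoid (G_ k) (@m_ k).

Definition sum_mean (E : set X) : R := ulim U (fun k => m_ (slice E k)).

Lemma slice_mean01 E k : 0 <= m_ (slice E k) <= 1.
Proof. by rewrite (mean_ge0 (Km k)) (mean_le1 (Km k)). Qed.

Lemma sum_mean_groupoid : mean_groupoid K sum_mean.
Proof.
split.
- by move=> E; apply: ulim_ge0 => //; apply: slice_mean01.
- move=> E F EF; rewrite /sum_mean -(ulimD HU (slice_mean01 E) (slice_mean01 F)).
  congr ulim; apply/funext => k; rewrite -(meanU (Km k))// -subset0 => a [Ea Fa].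
  by have : (E `&` F) (Tagged T_ a) by []; rewrite EF.
- by move=> E; apply: ulim_le1 => //; apply: slice_mean01.
- move=> a ba; congr ulim; apply/funext => k; rewrite slice_src slice_rng.
  by rewrite (mean_inv (Km k))//; apply: slice_bisection.
Qed.

End SumGroupoid.

Arguments slice {T_} Y k.

(** * Finite pmp groupoids as groupoids with a mean *)

Section FinitePmp.
Context {R : realType} {d : measure_display} {T : measurableType d}.
Variables (G : groupoid T) (mu : probability T R) (Gpmp : pmp_groupoid G mu).
Hypothesis finG : finite_set (arrows G).

Lemma standard_borel_set1 (x : T) : standard_borel R T -> measurable [set x].
Proof.
move=> [P [f [haus _ [g fg gf] mE]]]; apply/mE; rewrite image_set1.
rewrite -[X in <<s _ >> X]setCK -setTD; apply: sigma_algebraCD.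
apply: sub_sigma_algebra; apply: closed_openC.
by apply: accessible_closed_set1; apply: hausdorff_accessible.
Qed.

Lemma finite_arrows_measurable (E : set T) : E `<=` arrows G -> measurable E.
Proof.
move=> EA; have [sb _ _ _ _ _] := pmp_discrete Gpmp.
apply: countable_measurable; first by move=> t; apply: standard_borel_set1.
by apply: finite_set_countable; apply: sub_finite_set finG.
Qed.

(* The intersection with the units makes the argument measurable for every E,
   so that additivity holds without side condition. *)
Definition unit_mean (E : set T) : R := fine (mu (E `&` units G)).

Lemma unit_mean_groupoid : mean_groupoid G unit_mean.
Proof.
have mu' (E : set T) : measurable (E `&` units G).
  by apply: finite_arrows_measurable => x [_ ux]; apply: units_arrow ux.
split.
- by move=> E; apply: prob_ge0.
- move=> E F EF; rewrite /unit_mean setIUl probU//.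
  by rewrite setIACA EF set0I.
- move=> E; rewrite -[leRHS]/(fine 1%E) fine_le ?fin_num_measure//.
  exact: probability_le1.
- move=> a ba; rewrite /unit_mean.
  have Ba : full_semigroup_B G a.
    by apply/full_semigroup_BE; split=> //; apply: finite_arrows_measurable; case: ba.
  have aA := fsB_arrows Ba.
  rewrite (setIidl (src_image_sub aA)) (setIidl (rng_image_sub aA)).
  by rewrite (mu_src_rng Gpmp Ba).
Qed.

End FinitePmp.

(** * Finite groupoids carried by the real line *)

Lemma measurable_realType_set1 (R : realType) (x : measurableTypeR R) :
  measurable [set x].
Proof. exact: measurable_set1. Qed.

Lemma standard_borel_realType (R : realType) : standard_borel R (measurableTypeR R).
Proof.
exists R, id; split.
- exact: Rhausdorff.
- exists (range (@ratr R)).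
    by apply: card_le_trans (card_image_le _ _) _; apply: countableP.
  exact: dense_rat.
- by exists id.
- move=> A; rewrite image_id; split.
    have -> : measurable A = (@RGenOpens.G R).-sigma.-measurable A.
      by rewrite -RGenOpens.measurableE.
    move: A; apply: smallest_sub; first exact: smallest_sigma_algebra.
    by move=> _ [x [y ->]]; apply: sub_sigma_algebra; apply: interval_open.
  apply: smallest_sub; first exact: sigma_algebra_measurable.
  by move=> B oB; apply: open_measurable.
Qed.

Lemma measurable_fun_finite (d d' : measure_display) (S : measurableType d)
    (S' : measurableType d') (D : set S) (f : S -> S') :
  (forall x : S, measurable [set x]) -> finite_set D -> measurable_fun D f.
Proof.
move=> m1 fD _ B mB; apply: countable_measurable => //.
by apply: finite_set_countable; apply: sub_finite_set fD; apply: subIsetl.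
Qed.

Section Transport.
Context {R : realType} {Y : Type} (M : groupoid Y) (w : set Y -> R).
Hypotheses (Mw : mean_groupoid M w) (w1 : w (units M) = 1).
Hypothesis finM : finite_set (arrows M).
Variables (e : Y -> R) (e' : R -> Y).
Hypothesis eK : forall y, arrows M y -> e' (e y) = y.
Local Notation S := (measurableTypeR R).
Local Notation A := (arrows M).

(* [M] is copied along [e]; only the values of [e'] on [e @` A] matter. *)
Definition tr_mul (x y : S) : S := e (gmul M (e' x) (e' y)).
Definition tr_inv (x : S) : S := e (ginv M (e' x)).

Let e_inj a b : A a -> A b -> e a = e b -> a = b.
Proof. by move=> Aa Ab /(congr1 e'); rewrite !eK. Qed.

Let inv_e a : A a -> tr_inv (e a) = e (ginv M a).
Proof. by move=> Aa; rewrite /tr_inv eK. Qed.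

Let mul_e a b : A a -> A b -> tr_mul (e a) (e b) = e (gmul M a b).
Proof. by move=> Aa Ab; rewrite /tr_mul !eK. Qed.

Lemma tr_axioms : groupoid_axioms (e @` A) tr_mul tr_inv.
Proof.
have ss a : A a -> tr_mul (tr_inv (e a)) (e a) = e (src M a).
  by move=> Aa; rewrite inv_e// mul_e//; apply: ginv_arrow.
have rr a : A a -> tr_mul (e a) (tr_inv (e a)) = e (rng M a).
  by move=> Aa; rewrite inv_e// mul_e//; apply: ginv_arrow.
have sr a b : A a -> A b -> tr_mul (tr_inv (e a)) (e a) = tr_mul (e b) (tr_inv (e b)) ->
    src M a = rng M b.
  move=> Aa Ab; rewrite ss// rr// => /e_inj; apply; first exact: src_arrow.
  exact: rng_arrow.
split.
- move=> _ [a Aa <-]; rewrite inv_e//; exists (ginv M a) => //; exact: ginv_arrow.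
- move=> _ [a Aa <-]; rewrite inv_e// inv_e ?ginvK//; exact: ginv_arrow.
- move=> _ _ [a Aa <-] [b Ab <-] /(sr _ _ Aa Ab) ab; rewrite mul_e//.
  by exists (gmul M a b) => //; apply: gmul_arrow.
- move=> _ _ [a Aa <-] [b Ab <-] /(sr _ _ Aa Ab) ab; rewrite mul_e//.
  by rewrite !ss ?src_gmul//; apply: gmul_arrow.
- move=> _ _ [a Aa <-] [b Ab <-] /(sr _ _ Aa Ab) ab; rewrite mul_e//.
  by rewrite !rr ?rng_gmul//; apply: gmul_arrow.
- move=> _ _ _ [a Aa <-] [b Ab <-] [c Ac <-] /(sr _ _ Aa Ab) ab /(sr _ _ Ab Ac) bc.
  have [Aab Abc] := (gmul_arrow Aa Ab ab, gmul_arrow Ab Ac bc).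
  by rewrite (mul_e Aa Ab) (mul_e Ab Ac) (mul_e Aab Ac) (mul_e Aa Abc) gmulA.
- move=> _ [a Aa <-]; rewrite ss// mul_e ?gmul_src//; exact: src_arrow.
- move=> _ [a Aa <-]; rewrite rr// mul_e ?gmul_rng//; exact: rng_arrow.
Qed.

Definition tr_groupoid : groupoid S := Groupoid tr_axioms.
Local Notation N := tr_groupoid.

Lemma tr_src a : A a -> src N (e a) = e (src M a).
Proof.
by move=> Aa; rewrite /src /= inv_e// mul_e//; apply: ginv_arrow.
Qed.

Lemma tr_rng a : A a -> rng N (e a) = e (rng M a).
Proof.
by move=> Aa; rewrite /rng /= inv_e// mul_e//; apply: ginv_arrow.
Qed.

Lemma tr_finite : finite_set (arrows N).
Proof. exact: finite_image. Qed.

Lemma tr_measurable (E : set S) : E `<=` arrows N -> measurable E.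
Proof.
move=> EN; apply: countable_measurable; first exact: measurable_realType_set1.
by apply: finite_set_countable; apply: sub_finite_set tr_finite.
Qed.

Lemma tr_src_image Z : Z `<=` A -> src N @` (e @` Z) = e @` (src M @` Z).
Proof.
move=> ZA; rewrite !image_comp; apply: eq_imagel => a Za.
exact: tr_src (ZA _ Za).
Qed.

Lemma tr_rng_image Z : Z `<=` A -> rng N @` (e @` Z) = e @` (rng M @` Z).
Proof.
move=> ZA; rewrite !image_comp; apply: eq_imagel => a Za.
exact: tr_rng (ZA _ Za).
Qed.

Lemma tr_setY Z Z' : Z `<=` A -> Z' `<=` A -> e @` Z `+` e @` Z' = e @` (Z `+` Z').
Proof.
move=> ZA ZA'.
have h V V' : V `<=` A -> V' `<=` A -> e @` V `\` e @` V' = e @` (V `\` V').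
  move=> VA VA'; apply/seteqP; split=> [_ [[a Va <-] n]|_ [a [Va n] <-]].
    by exists a => //; split=> // Va'; apply: n; exists a.
  split; first by exists a.
  move=> [b Vb ba]; apply: n; rewrite -(e_inj (VA' _ Vb) (VA _ Va) ba)//.
by rewrite !setY_def !h// image_setU.
Qed.

Lemma tr_gmul Z Z' : Z `<=` A -> Z' `<=` A ->
  set_gmul N (e @` Z) (e @` Z') = e @` (set_gmul M Z Z').
Proof.
move=> ZA ZA'; apply/seteqP; split=> [x /set_gmulP|_ [c /set_gmulP + <-]].
  move=> [_ [_ [[[a Za <-] [b Zb <-] _ _] [ab <-]]]].
  have [Aa Ab] := (ZA _ Za, ZA' _ Zb).
  exists (gmul M a b); last by rewrite /= mul_e.
  apply/set_gmulP; exists a, b; do !split=> //.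
  move: ab; rewrite tr_src// tr_rng// => /e_inj; apply; first exact: src_arrow.
  exact: rng_arrow.
move=> [a [b [[Za Zb Aa Ab] [ab <-]]]]; apply/set_gmulP; exists (e a), (e b).
split; first by split; [exists a|exists b|exists a|exists b].
by rewrite tr_src// tr_rng// ab /= mul_e.
Qed.

Lemma tr_bisection Z : bisection M Z -> full_semigroup_B N (e @` Z).
Proof.
move=> bZ; have ZA : Z `<=` A by case: bZ.
have sub : e @` Z `<=` arrows N by apply: image_subset.
apply/full_semigroup_BE; split; first exact: tr_measurable.
apply: bisectionP => //.
  move=> _ _ [a Za <-] [b Zb <-]; have [Aa Ab] := (ZA _ Za, ZA _ Zb).
  rewrite !tr_src// => /(e_inj (src_arrow Aa) (src_arrow Ab)) ab.
  by rewrite (bisection_src bZ Za Zb).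
move=> _ _ [a Za <-] [b Zb <-]; have [Aa Ab] := (ZA _ Za, ZA _ Zb).
rewrite !tr_rng// => /(e_inj (rng_arrow Aa) (rng_arrow Ab)) ab.
by rewrite (bisection_rng bZ Za Zb).
Qed.

Lemma bisection_tr a : full_semigroup_B N a -> exists2 Z, bisection M Z & a = e @` Z.
Proof.
move=> Ba; have bN := fsB_bisection Ba; have aN := fsB_arrows Ba.
exists (A `&` e @^-1` a).
  apply: bisectionP => [? []//|y z [Ay ay] [Az az] yz|y z [Ay ay] [Az az] yz].
    by apply: e_inj => //; apply: (bisection_src bN) => //; rewrite !tr_src// yz.
  by apply: e_inj => //; apply: (bisection_rng bN) => //; rewrite !tr_rng// yz.
apply/seteqP; split=> [x ax|_ [y [_ ay] <-]//].
by have [y Ay yx] := aN _ ax; exists y => //; split=> //=; rewrite yx.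
Qed.

(** The push-forward of [w] along [e], cut down to the units so that it is carried by finitely many
    points. *)
Definition tr_mu (E : set S) : \bar R := (w (units M `&` e @^-1` E))%:E.

Let tr_mu0 : tr_mu set0 = 0%E.
Proof. by rewrite /tr_mu preimage_set0 setI0 (mean0 Mw). Qed.

Let tr_mu_ge0 E : (0 <= tr_mu E)%E.
Proof. by rewrite lee_fin (mean_ge0 Mw). Qed.

(** Finite additivity suffices: each of the finitely many units enters the union at some index, so
    the partial unions are constant on units from the largest such index on. *)
Let tr_mu_sigma : semi_sigma_additive tr_mu.
Proof.
move=> F mF tF mUF.
have sumE n : (\sum_(0 <= i < n) tr_mu (F i))%E = tr_mu (\bigcup_(i < n) F i).
  elim: n => [|n ih]; first by rewrite big_geq// bigcup_mkord big_ord0 tr_mu0.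
  rewrite big_nat_recr//= ih -EFinD -(meanU Mw).
    congr (w _)%:E; apply/seteqP; split=> [y|y [uy [i /= + Fi]]].
      move=> [[uy [i /= ni Fi]]|[uy Fn]]; split=> //; last by exists n => /=.
      by exists i => //=; apply: ltnW.
    rewrite ltnS leq_eqVlt => /orP[/eqP<-|ni]; first by right.
    by left; split=> //; exists i.
  rewrite -subset0 => y [[_ [i /= ni Fi]] [_ Fn]].
  have := tF i n I I; move=> /(_ (ex_intro _ (e y) (conj Fi Fn))) ein.
  by move: ni; rewrite ein ltnn.
have /choice[f fP] : forall y, exists i, (\bigcup_i F i) (e y) -> F i (e y).
  move=> y; have [[i _ Fi]|n] := pselect ((\bigcup_i F i) (e y)); first by exists i.
  by exists 0%N.
have finU : finite_set (units M) by apply: sub_finite_set finM => y uy; apply: units_arrow uy.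
have [n0 n0P] := finite_nat_bounded (finite_image f finU).
apply: cvg_near_cst; exists n0 => // n /= n0n; rewrite sumE.
congr (w _)%:E; apply/seteqP; split=> y [uy].
  by move=> [i _ Fi]; split=> //; exists i.
move=> Uy; split=> //; exists (f y); last exact: fP.
by apply: leq_trans (n0P _ _) n0n; exists y.
Qed.

HB.instance Definition _ :=
  isMeasure.Build _ S R tr_mu tr_mu0 tr_mu_ge0 tr_mu_sigma.

Let tr_muT : tr_mu setT = 1%E.
Proof. by rewrite /tr_mu preimage_setT setIT w1. Qed.

HB.instance Definition _ := Measure_isProbability.Build _ S R tr_mu tr_muT.

Definition tr_prob : probability S R := tr_mu.

Lemma tr_prob_image E : E `<=` units M -> tr_prob (e @` E) = (w E)%:E.
Proof.
move=> EU; congr (w _)%:E; apply/seteqP; split=> [y [uy [z Ez zy]]|y Ey].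
  by rewrite -(e_inj _ _ zy)//; [apply: units_arrow; apply: EU|apply: units_arrow].
by split; [apply: EU|exists y].
Qed.

Lemma tr_dist Z Z' : Z `<=` A -> Z' `<=` A ->
  fine (tr_prob (src N @` (e @` Z `+` e @` Z'))) = w (src M @` (Z `+` Z')).
Proof.
move=> ZA ZA'; have sub : Z `+` Z' `<=` A by move=> y [[/ZA]|[/ZA']].
by rewrite tr_setY// tr_src_image// tr_prob_image//; apply: src_image_sub.
Qed.

Lemma tr_pmp : pmp_groupoid N tr_prob.
Proof.
have m2 (x : S * S) : measurable [set x].
  case: x => x y; have -> : [set (x, y)] = [set x] `*` [set y].
    by apply/seteqP; split=> [_ ->//|[u v] [/= -> ->]].
  by apply: measurableX; apply: measurable_realType_set1.
have fC : finite_set (composable N).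
  apply: (@sub_finite_set _ _ (arrows N `*` arrows N)) => [[x y] []//|].
  by apply: finite_setX; apply: tr_finite.
split; first split.
- exact: standard_borel_realType.
- exact: tr_measurable.
- by apply: measurable_fun_finite tr_finite; apply: measurable_realType_set1.
- by apply: countable_measurable => //; apply: finite_set_countable.
- exact: measurable_fun_finite.
- move=> x _; apply: finite_set_countable; apply: sub_finite_set tr_finite.
  by move=> y [].
- have -> : units N = e @` units M by rewrite /units tr_src_image.
  by rewrite tr_prob_image// w1.
- move=> _ /bisection_tr[Z bZ ->]; have ZA : Z `<=` A by case: bZ.
  rewrite tr_src_image// tr_rng_image// !tr_prob_image ?(mean_inv Mw)//.
    exact: rng_image_sub.
  exact: src_image_sub.
Qed.

End Transport.

(** Elements are numbered by naturals, read as reals; a point of [D] serves as value of the inverse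
    off the image. *)
Lemma finite_coding (R : realType) (Y : Type) (D : set Y) : finite_set D ->
  D !=set0 -> exists p : (Y -> R) * (R -> Y), forall y, D y -> p.2 (p.1 y) = y.
Proof.
move=> /finite_set_countable/countable_injP[g gi] [y0 Dy0].
have /choice[e' e'P] : forall x : R, exists y,
    forall y', D y' -> (g y')%:R = x -> y = y'.
  move=> x; have [[y [Dy yx]]|n] := pselect (exists y, D y /\ (g y)%:R = x).
    exists y => y' Dy' y'x; apply: gi; rewrite ?inE//.
    by apply/eqP; rewrite -(eqr_nat R) yx y'x.
  by exists y0 => y' Dy' y'x; case: n; exists y'.
by exists (fun y => (g y)%:R, e') => y Dy /=; apply: e'P.
Qed.

(** * Slices of the amplified disjoint union *)

Section AmpSlice.
Context {T_ : nat -> Type} (G_ : forall k, groupoid (T_ k)) (n : nat).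
Local Notation X := {k : nat & T_ k}.
Local Notation K := (sum_groupoid G_).

Definition amp_slice (Y : set (X * ('I_n * 'I_n))) k : set (T_ k * ('I_n * 'I_n)) :=
  [set x | Y (Tagged T_ x.1, x.2)].
Arguments amp_slice Y k : clear implicits.

Lemma amp_slice_src Y k :
  amp_slice (src (amp n K) @` Y) k = src (amp n (G_ k)) @` amp_slice Y k.
Proof.
apply/seteqP; split=> -[a [i j]].
  move=> [[x [i' j']] Yx e].
  have : slice (src K @` blk Y i' j') k a by exists x => //; exact: (congr1 fst e).
  rewrite slice_src => -[b Yb <-]; exists (b, (i', j')) => //.
  by rewrite amp_src; congr pair; exact: (congr1 snd e).
move=> [[b [i' j']] Yb e]; exists (Tagged T_ b, (i', j')) => //.
rewrite amp_src; congr pair; last exact: (congr1 snd e).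
by rewrite [LHS]src_sum; congr Tagged; exact: (congr1 fst e).
Qed.

Lemma amp_slice_gmul Y Z k : amp_slice (set_gmul (amp n K) Y Z) k =
  set_gmul (amp n (G_ k)) (amp_slice Y k) (amp_slice Z k).
Proof.
have blkE V i j : blk (amp_slice V k) i j = slice (blk V i j) k by [].
have ext (V W : set (T_ k * ('I_n * 'I_n))) :
    (forall i j, blk V i j = blk W i j) -> V = W.
  move=> VW; apply/seteqP; split=> -[a [i j]] h.
    by have : blk V i j a by []; rewrite VW.
  by have : blk W i j a by []; rewrite -VW.
apply: ext => i l; rewrite blkE !blk_gmul.
under [RHS]eq_bigcupr do rewrite !blkE -slice_gmul.
by apply/seteqP; split=> a.
Qed.

Let tagged_pair_inj k (a b : T_ k) (p q : 'I_n * 'I_n) :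
  (Tagged T_ a, p) = (Tagged T_ b, q) -> (a, p) = (b, q).
Proof.
move=> e; have [e1 e2] := (congr1 fst e, congr1 snd e); congr pair => //.
move: e1 => /(congr1 (tagged_as (Tagged T_ a))).
by rewrite !(tagged_asE (u := Tagged T_ a)).
Qed.

Lemma amp_slice_bisection Y k : bisection (amp n K) Y ->
  bisection (amp n (G_ k)) (amp_slice Y k).
Proof.
move=> bY; have [YA _ _] := bY.
apply: bisectionP => [x /YA//|[a p] [b q] Ya Yb|[a p] [b q] Ya Yb].
  rewrite !amp_src => e; have [e1 e2] := (congr1 fst e, congr1 snd e).
  apply: tagged_pair_inj; apply: (bisection_src bY Ya Yb).
  rewrite !amp_src; congr pair; last exact: e2.
  by rewrite [LHS]src_sum [RHS]src_sum; congr Tagged; exact: e1.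
rewrite !amp_rng => e; have [e1 e2] := (congr1 fst e, congr1 snd e).
apply: tagged_pair_inj; apply: (bisection_rng bY Ya Yb).
rewrite !amp_rng; congr pair; last exact: e2.
by rewrite [LHS]rng_sum [RHS]rng_sum; congr Tagged; exact: e1.
Qed.

Lemma amp_slice_mean (R : realType) (U : set_system nat) (m_ : forall k, set (T_ k) -> R)
    (E : set (X * ('I_n * 'I_n))) : UltraFilter U ->
    (forall k, mean_groupoid (G_ k) (@m_ k)) ->
  amp_mean (sum_mean U m_) E = ulim U (fun k => amp_mean (@m_ k) (amp_slice E k)).
Proof.
move=> HU Km; rewrite /amp_mean.
rewrite (ulim_average HU (v := fun j k => m_ k (slice (blk E j j) k)))// => j k.
exact: (slice_mean01 Km (blk E j j) k).
Qed.

End AmpSlice.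

Arguments amp_slice {T_ n} Y k.

Theorem theorem3p3 (R : realType) (U : set_system nat)
    (HU : free_ultrafilter U)
    (d : measure_display) (T : measurableType d)
    (G : groupoid T) (mu : probability T R) (Gpmp : pmp_groupoid G mu)
    (H : set T) (HG : is_subgroupoid G H) (Hindex : finite_index G mu H) :
  sofic U (subgroupoid HG) mu -> sofic U G mu.
Proof.
have UF : UltraFilter U by case: HU.
have [n [psi [psifull psicover psidisj]]] := Hindex.
move=> [d_ [T_ [G_ [mu_ [Gfin [f0 [fdom0 fdist0 fmul0]]]]]]].
pose f : set T -> forall k, set (T_ k) := f0.
pose L := subgroupoid HG.
have fdom a : full_semigroup_B L a -> forall k, full_semigroup_B (G_ k) (f a k).
  exact: fdom0.
have fdist a b : full_semigroup_B L a -> full_semigroup_B L b ->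
    ulim U (fun k => fine (mu_ k (src (G_ k) @` (f a k `+` f b k)))) =
    fine (mu (src L @` (a `+` b))) by exact: fdist0.
have fmul a b : full_semigroup_B L a -> full_semigroup_B L b ->
    ulim U (fun k => fine (mu_ k (src (G_ k) @` (f (set_gmul L a b) k `+`
      set_gmul (G_ k) (f a k) (f b k))))) = 0 by exact: fmul0.
have n_gt0 := finite_index_gt0 Gpmp psicover.
pose m_ k := unit_mean (G_ k) (mu_ k).
have Km k : mean_groupoid (G_ k) (m_ k).
  by case: (Gfin k) => pk fk; apply: unit_mean_groupoid.
pose K := sum_groupoid G_; pose lam := sum_mean U m_.
have Klam : mean_groupoid K lam by apply: sum_mean_groupoid.
pose g a : set {k & T_ k} := [set x | f a (tag x) (tagged x)].
have gB a : full_semigroup_B L a -> bisection K (g a).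
  move=> Ba; apply: bisection_slices => k.
  exact: (fsB_bisection (fdom a Ba k)).
have distE (x y : forall k, set (T_ k)) : (forall k, x k `<=` arrows (G_ k)) ->
    (forall k, y k `<=` arrows (G_ k)) ->
    lam (src K @` ([set z | x (tag z) (tagged z)] `+` [set z | y (tag z) (tagged z)])) =
    ulim U (fun k => fine (mu_ k (src (G_ k) @` (x k `+` y k)))).
  move=> xA yA; congr ulim; apply/funext => k.
  (* Sources are units, so the truncation in [unit_mean] has no effect on them. *)
  rewrite slice_src /m_ /unit_mean setIidl//.
  by apply: src_image_sub => z [[xz _]|[yz _]]; [exact: xA xz|exact: yA yz].
have gE : mean_embedding L mu K lam g.
  split=> // a b Ba Bb.
    rewrite -(fdist a b Ba Bb); apply: distE => k; first exact: fsB_arrows (fdom a Ba k).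
    exact: fsB_arrows (fdom b Bb k).
  have Bab := fsB_mul (pmp_discrete (sub_pmp Gpmp HG psifull psicover)) Ba Bb.
  have E : [set z : {k & T_ k} |
      set_gmul (G_ (tag z)) (f a (tag z)) (f b (tag z)) (tagged z)] =
      set_gmul K (g a) (g b).
    apply/seteqP; split=> -[k x].
      by have := slice_gmul G_ (g a) (g b) k => /seteqP[_ h] /h.
    by have := slice_gmul G_ (g a) (g b) k => /seteqP[h _] /h.
  have h : lam (src K @` (g (set_gmul L a b) `+` set_gmul K (g a) (g b))) = 0.
    rewrite -E -(fmul a b Ba Bb).
    apply: (distE _ (fun k => set_gmul (G_ k) (f a k) (f b k))) => k.
      exact: fsB_arrows (fdom _ Bab k).
    by move=> x /set_gmulP[y [z [[_ _ Ay Az] [yz <-]]]]; apply: gmul_arrow.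
  split; apply: (mean_null_sub Klam) h; apply: image_subset => x xy.
    by left.
  by right.
(* Amplifying the disjoint union and slicing it gives the amplifications [M k] of the single
   groupoids: these approximate [G], once copied into the real line. *)
pose F := amp_emb G H psi K g; pose M k := amp n (G_ k).
pose w_ k := amp_mean (n := n) (m_ k).
have Mw k : mean_groupoid (M k) (w_ k) by apply: amp_mean_groupoid.
have Mfin k : finite_set (arrows (M k)).
  have [_ fk] := Gfin k.
  apply: (@sub_finite_set _ _ (arrows (G_ k) `*` setT)) => [[x i] //|].
  by apply: finite_setX => //; apply: finite_finset.
have w1 k : w_ k (units (M k)) = 1.
  apply: (amp_mean_const n_gt0) => j; have [[_ mu1 _] _] := Gfin k.
  have -> : blk (units (M k)) j j = units (G_ k).
    rewrite /units blk_src; apply/seteqP; split=> [x [i _ [y Ay <-]]|_ [y Ay <-]].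
      by exists y.
    by exists j => //; exists y.
  by rewrite /m_ /unit_mean setIid mu1.
(* The units have mass 1, so there is an arrow; [finite_coding] needs one. *)
have M0 k : arrows (M k) !=set0.
  apply/set0P/eqP => A0; have := w1 k.
  have -> : units (M k) = set0 by rewrite /units A0 image_set0.
  by rewrite (mean0 (Mw k)) => /esym/eqP; rewrite oner_eq0.
pose e k := sval (cid (finite_coding R (Mfin k) (M0 k))).
have eK k : forall y, arrows (M k) y -> (e k).2 ((e k).1 y) = y.
  exact: (svalP (cid (finite_coding R (Mfin k) (M0 k)))).
pose N k := tr_groupoid (eK k); pose nu k := tr_prob (Mw k) (w1 k) (Mfin k) (e k).1.
pose F' a : forall k, set (measurableTypeR R) := fun k => (e k).1 @` amp_slice (F a) k.
have FB a : full_semigroup_B G a -> bisection (amp n K) (F a).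
  by move=> Ba; apply: (amp_emb_bisection Gpmp psifull gE).
have sA (Y : set ({k & T_ k} * ('I_n * 'I_n))) k : Y `<=` arrows (amp n K) ->
    amp_slice Y k `<=` arrows (M k) by move=> YA x /YA.
have dE (Y Z : set ({k & T_ k} * ('I_n * 'I_n))) : Y `<=` arrows (amp n K) ->
    Z `<=` arrows (amp n K) ->
    pdist (p := ultraproduct U (fun k => full_semigroup (N k) (nu k)))
      (fun k => (e k).1 @` amp_slice Y k) (fun k => (e k).1 @` amp_slice Z k) =
    amp_mean lam (src (amp n K) @` (Y `+` Z)).
  move=> YA ZA; rewrite (amp_slice_mean _ UF Km); congr (lim (_ @ U)); apply/funext => k.
  by rewrite amp_slice_src; apply: (tr_dist (Mw k)); apply: sA.
exists (fun=> _), (fun=> measurableTypeR R), N, nu; split.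
  by move=> k; split; [exact: tr_pmp|exact: tr_finite].
have FA a : full_semigroup_B G a -> F a `<=` arrows (amp n K).
  by move=> /FB[].
exists F'; split=> [a Ba k|a b Ba Bb|a b Ba Bb].
- by apply: tr_bisection => //; apply: amp_slice_bisection; apply: FB.
- rewrite [LHS]dE; [|exact: FA|exact: FA].
  exact: (amp_emb_dist Gpmp psifull psicover psidisj Klam gE).
have Bab := fsB_mul (pmp_discrete Gpmp) Ba Bb.
have FFA : set_gmul (amp n K) (F a) (F b) `<=` arrows (amp n K).
  by have [] := bisection_mul (FB _ Ba) (FB _ Bb).
(* The right-hand 0 is rewritten as an amplified distance, so that both sides become the same
   distance in the ultraproduct: slicing and transport commute with products exactly. *)
rewrite -[RHS](amp_emb_mul Gpmp psifull psicover psidisj Klam gE Ba Bb).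
rewrite -dE//; last exact: FA.
congr pdist; apply/funext => k; rewrite amp_slice_gmul.
by apply: (tr_gmul (eK k)); apply: sA; apply: FA.
Qed.
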